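(* Let $(E,\mathcal{B})=\operatorname{colim}_{n\in\mathbb{N}}(E_{B_n},\|\cdot\|_{B_n})^{\mathrm b}\in\mathbf{LBb}$, where $(B_n)_{n\in\mathbb{N}}$ is a sequence of Banach disks in $E$. Then $(E,\mathcal{B})$ belongs to $\mathbf{bLB}$ if and only if $(B_n)_{n\in\mathbb{N}}$ satisfies both of the following conditions: (I) for every $e\in E$ with $e\neq 0$ there exists a linear map $e'\colon E\to k$ such that $e'(e)\neq 0$ and $\sup_{b\in B_n}|e'(b)|<\infty$ for all $n\in\mathbb{N}$; (II) for every $n\in\mathbb{N}$ there exists $m\geqslant n$ such that the closure of $B_n$ in $(E,\mathcal{B})^{\mathrm t}$ is bounded in $(E_{B_m},\|\cdot\|_{B_m})^{\mathrm b}$ (in particular contained in $E_{B_m}$). In particular, $\mathbf{bLB}=\mathbf{LBb}\cap\mathbf{NBorn}$.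
   Context: Let $k\in\{\mathbb{R},\mathbb{C}\}$. A bornological $k$-vector space of convex type (bvs) is a $k$-vector space $E$ with a family $\mathcal{B}$ of subsets (''bounded sets'') that covers $E$ and is closed under subsets, finite unions, sums, scalar multiples and absolutely convex hulls; morphisms are the linear maps sending bounded sets to bounded sets. $\mathbf{Born}$ is the category of bvs. $\mathbf{Tc}$ is the category of (possibly non-Hausdorff) locally convex topological $k$-vector spaces (lcs) and continuous linear maps. The functor $(\cdot)^{\mathrm b}\colon\mathbf{Tc}\to\mathbf{Born}$ equips $(E,\tau)$ with all its $\tau$-bounded sets; $(\cdot)^{\mathrm t}\colon\mathbf{Born}\to\mathbf{Tc}$ equips $(E,\mathcal{B})$ with the topology having as basis of $0$-neighbourhoods all absolutely convex bornivorous sets (those absorbing every $B\in\mathcal{B}$). $\mathbf{NBorn}$ is the full subcategory of $\mathbf{Born}$ of all $(E,\mathcal{B})$ with $((E,\mathcal{B})^{\mathrm t})^{\mathrm b}\cong(E,\mathcal{B})$, i.e. such that $\mathcal{B}$ is exactly the family of bounded sets of $(E,\mathcal{B})^{\mathrm t}$. (Semi-)normed spaces are regarded as lcs. For a non-empty absolutely convex subset $B$ of a vector space $E$, let $E_B=\operatorname{span}B$ with the Minkowski functional $\|e\|_B=\inf\{\lambda>0: e\in\lambda B\}$; $B$ is a Banach disk in $E$ if $(E_B,\|\cdot\|_B)$ is a Banach space. An LB-space is an lcs $(E,\tau)\cong\operatorname{colim}_{n\in\mathbb{N}}(E_n,\|\cdot\|_n)$ (colimit in $\mathbf{Tc}$)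 for some sequence of Banach spaces $(E_1,\|\cdot\|_1)\to(E_2,\|\cdot\|_2)\to\cdots$ with injective continuous linear linking maps (a defining sequence). It is regular if $(E,\tau)^{\mathrm b}\cong\operatorname{colim}_n(E_n,\|\cdot\|_n)^{\mathrm b}$ in $\mathbf{Born}$ for some (equivalently, every) defining sequence; that is, every bounded subset of $(E,\tau)$ is contained and bounded in some $(E_n,\|\cdot\|_n)$. $\mathbf{bLB}$ is the full subcategory of $\mathbf{Born}$ of all $(E,\mathcal{B})\cong(E,\tau)^{\mathrm b}$ with $(E,\tau)$ a regular LB-space. $\mathbf{LBb}$ is the full subcategory of $\mathbf{Born}$ of all $(E,\mathcal{B})\cong\operatorname{colim}_{n\in\mathbb{N}}(E_n,\|\cdot\|_n)^{\mathrm b}$ (colimit in $\mathbf{Born}$) for a sequence of Banach spaces with injective continuous linear linking maps. Writing $(E,\mathcal{B})=\operatorname{colim}_{n\in\mathbb{N}}(E_{B_n},\|\cdot\|_{B_n})^{\mathrm b}$ includes that $E_{B_n}\subseteq E_{B_{n+1}}$ with bounded inclusion for all $n$; it then means that $E=\bigcup_n E_{B_n}$ and that a subset of $E$ belongs to $\mathcal{B}$ iff it is contained and bounded in some $(E_{B_n},\|\cdot\|_{B_n})$. *)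

(* Defs.v *)
From HB Require Import structures.
From mathcomp Require Import all_boot all_order all_algebra.
From mathcomp Require Import complex.
From mathcomp Require Import all_classical all_reals all_analysis.

Set Implicit Arguments.
Unset Strict Implicit.
Unset Printing Implicit Defensive.

Import Order.TTheory GRing.Theory Num.Theory.
Import numFieldNormedType.Exports.

Local Open Scope classical_set_scope.
Local Open Scope ring_scope.

(** The definitions are given over an arbitrary [numFieldType] [K] and used
    only for [K] among the real and the complex numbers.  In [R[i]] the order
    is partial: [0 < l] says that [l] is a positive real, [`|z|] is the modulus
    viewed as an element of [R[i]], and a comparison of nonnegative elements is
    a comparison of reals. *)
Inductive scalar_kind := RealScalars | ComplexScalars.

Definition scalars (R : realType) (k : scalar_kind) : numFieldType :=
  match k with
  | RealScalars => (R : numFieldType)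
  | ComplexScalars => (R[i]%C : numFieldType)
  end.

Lemma half_half (K : numFieldType) : 2^-1 + 2^-1 = 1 :> K.
Proof. by rewrite [RHS](splitr 1) mul1r. Qed.

Section AbsolutelyConvex.
Context {K : numFieldType} {E : lmodType K}.
Implicit Types (A V : set E).

Definition abs_convex A : Prop := forall (a b : K) (x y : E),
  `|a| + `|b| <= 1 -> A x -> A y -> A (a *: x + b *: y).

Definition abs_convex_hull A : set E := smallest abs_convex A.

Definition absorbs V A : Prop := exists2 r : K, 0 < r &
  forall a : K, r <= `|a| -> A `<=` [set a *: v | v in V].

Lemma abs_convex_hull_convex A : abs_convex (abs_convex_hull A).
Proof.
move=> a b x y ab hx hy C [cC AC].
exact: (cC a b x y ab (hx C (conj cC AC)) (hy C (conj cC AC))).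
Qed.

Lemma abs_convex_scale A (c : K) :
  abs_convex A -> abs_convex [set c *: x | x in A].
Proof.
move=> cA a b _ _ ab [x Ax <-] [y Ay <-].
exists (a *: x + b *: y); first exact: cA.
by rewrite scalerDr !scalerA mulrC (mulrC c b).
Qed.

Lemma absorbs_scale V A (c : K) :
  c != 0 -> absorbs V A -> absorbs [set c *: v | v in V] A.
Proof.
move=> c0 [r r0 rA]; have nc : 0 < `|c| by rewrite normr_gt0.
exists (r / `|c|); first by rewrite divr_gt0.
move=> a ra x Ax.
have [|v Vv <-] := rA (a * c) _ x Ax; first by rewrite normrM -ler_pdivrMr.
by exists (c *: v); [exists v|rewrite scalerA].
Qed.

Lemma absorbsI V W A : absorbs V A -> absorbs W A -> absorbs (V `&` W) A.
Proof.
move=> [r r0 rA] [s s0 sA]; exists (r + s); first exact: addr_gt0.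
move=> a rsa x Ax.
have ra : r <= `|a| by apply: le_trans rsa; rewrite lerDl ltW.
have sa : s <= `|a| by apply: le_trans rsa; rewrite lerDr ltW.
have a0 : a != 0 by rewrite -normr_gt0; apply: lt_le_trans ra.
have [v Vv vx] := rA a ra x Ax; have [w Ww wx] := sA a sa x Ax.
have vw : v = w by apply: (scalerI a0); rewrite vx wx.
by exists v => //; split=> //; rewrite vw.
Qed.

End AbsolutelyConvex.

(** [E] with a [bornology E] is a bornological vector space of convex type. *)
Record bornology (K : numFieldType) (E : lmodType K) := Bornology {
  bounded_sets :> set E -> Prop;
  bornology_cover : forall x : E, exists2 A, bounded_sets A & A x;
  bornology_sub : forall A C, A `<=` C -> bounded_sets C -> bounded_sets A;
  bornologyU : forall A C,
    bounded_sets A -> bounded_sets C -> bounded_sets (A `|` C);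
  bornologyD : forall A C, bounded_sets A -> bounded_sets C ->
    bounded_sets [set x + y | x in A & y in C];
  bornologyZ : forall (a : K) A,
    bounded_sets A -> bounded_sets [set a *: x | x in A];
  bornology_hull : forall A,
    bounded_sets A -> bounded_sets (abs_convex_hull A)
}.

Section Born.
Context {K : numFieldType}.

Definition bounded_map (E F : lmodType K) (B : bornology E) (C : bornology F)
    (u : E -> F) : Prop :=
  forall A, B A -> C [set u x | x in A].

Definition born_iso (E F : lmodType K) (B : bornology E) (C : bornology F) :
    Prop :=
  exists (u : {linear E -> F}) (v : {linear F -> E}),
    [/\ bounded_map B C u, bounded_map C B v, cancel u v & cancel v u].

Definition bornivorous (E : lmodType K) (B : bornology E) (V : set E) : Prop :=
  forall A, B A -> absorbs V A.

(** The locally convex space [(E, B)^t]: the carrier [E], with [B] recorded so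
    that the topology can be inferred. *)
Definition born_top (E : lmodType K) (B : bornology E) : Type := E.

Definition born_top_nbhs (E : lmodType K) (B : bornology E) (x : E) :
    set (set E) :=
  [set U | exists V, [/\ abs_convex V, bornivorous B V &
                        [set x + v | v in V] `<=` U]].

End Born.

Section BornTop.
Context {K : numFieldType} {E : lmodType K} (B : bornology E).

HB.instance Definition _ := GRing.Lmodule.copy (born_top B) E.

HB.instance Definition _ := hasNbhs.Build (born_top B) (born_top_nbhs B).

Let bornivorous_absorbs1 (V : set E) (x : E) : bornivorous B V ->
  exists2 r : K, 0 < r & forall a, r <= `|a| -> exists2 v, V v & a *: v = x.
Proof.
move=> bV; have [A BA Ax] := bornology_cover B x.
by have [r r0 rA] := bV A BA; exists r => // a ra; exact: rA.
Qed.

Let bornivorous0 (V : set E) : abs_convex V -> bornivorous B V -> V 0.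
Proof.
move=> cV /(@bornivorous_absorbs1 _ 0)[r r0 /(_ r)].
rewrite gtr0_norm// => /(_ (lexx _))[v Vv _].
have := cV 0 0 v v; rewrite !scale0r addr0; apply => //.
by rewrite normr0 addr0.
Qed.

Let half_add (V : set E) (x y : E) : abs_convex V ->
  [set 2^-1 *: v | v in V] x -> [set 2^-1 *: v | v in V] y -> V (x + y).
Proof.
move=> cV [v Vv <-] [w Vw <-]; apply: cV => //.
by rewrite ger0_norm ?invr_ge0// half_half.
Qed.

Let bornivorousZ (V : set E) (c : K) : c != 0 ->
  bornivorous B V -> bornivorous B [set c *: v | v in V].
Proof. by move=> c0 bV A BA; apply: absorbs_scale => //; exact: bV. Qed.

Let half0 : 2^-1 != 0 :> K.
Proof. by rewrite invr_eq0 pnatr_eq0. Qed.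

Let born_top_filter (x : born_top B) : ProperFilter (nbhs x).
Proof.
split.
  move=> [V [cV bV /(_ x)]]; apply; exists 0; first exact: bornivorous0.
  by rewrite addr0.
split.
- exists setT; split=> // A BA; exists 1 => // a a1 y _.
  exists (a^-1 *: y) => //; rewrite scalerA divff ?scale1r//.
  by rewrite -normr_gt0; apply: lt_le_trans a1.
- move=> P Q [V [cV bV VP]] [W [cW bW WQ]]; exists (V `&` W); split.
  + by move=> a b y z ab [Vy Wy] [Vz Wz]; split; [exact: cV|exact: cW].
  + by move=> A BA; apply: absorbsI; [exact: bV|exact: bW].
  + by move=> _ [v [Vv Wv] <-]; split; [apply: VP|apply: WQ]; exists v.
- by move=> P Q PQ [V [cV bV VP]]; exists V; split=> // y /VP /PQ.
Qed.

Let born_top_singleton (x : born_top B) (A : set (born_top B)) :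
  nbhs x A -> A x.
Proof.
move=> [V [cV bV]]; apply; exists 0; first exact: bornivorous0.
by rewrite addr0.
Qed.

Let born_top_nbhs_nbhs (x : born_top B) (A : set (born_top B)) :
  nbhs x A -> nbhs x (nbhs^~ A).
Proof.
move=> [V [cV bV VA]]; exists [set 2^-1 *: v | v in V]; split.
- exact: abs_convex_scale.
- exact: bornivorousZ.
- move=> _ [v hv <-]; exists [set 2^-1 *: v | v in V]; split.
  + exact: abs_convex_scale.
  + exact: bornivorousZ.
  + move=> _ [w hw <-]; apply: VA; exists (v + w); last by rewrite addrA.
    exact: half_add.
Qed.

HB.instance Definition _ := Nbhs_isNbhsTopological.Build (born_top B)
  born_top_filter born_top_singleton born_top_nbhs_nbhs.

Let born_top_add : continuous (fun z : born_top B * born_top B => z.1 + z.2).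
Proof.
move=> [x y] /= U [V [cV bV VU]].
pose W : set E := [set 2^-1 *: v | v in V].
have nW (z : born_top B) : nbhs z [set z + w | w in W].
  by exists W; split=> //; [exact: abs_convex_scale|exact: bornivorousZ].
exists ([set x + w | w in W], [set y + w | w in W]); first by split; exact: nW.
move=> [_ _] [/= [v hv <-] [w hw <-]]; apply: VU => /=.
by exists (v + w); [exact: half_add|rewrite addrACA].
Qed.

Let born_top_scale : continuous (fun z : K^o * born_top B => z.1 *: z.2).
Proof.
move=> [a x] /= U [V [cV bV VU]].
have [r r0 rV] := bornivorous_absorbs1 x bV.
pose d : K := (2 * r)^-1.
have d0 : 0 < d by rewrite invr_gt0 mulr_gt0.
pose c : K := (2 * (`|a| + d))^-1.
have ad0 : 0 < `|a| + d by rewrite ltr_wpDl.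
have c0 : 0 < c by rewrite invr_gt0 mulr_gt0.
exists (ball (a : K^o) d, [set x + w | w in [set c *: v | v in V]]).
  split; first exact: nbhsx_ballx.
  exists [set c *: v | v in V]; split=> //; first exact: abs_convex_scale.
  by apply: bornivorousZ => //; rewrite gt_eqF.
move=> [b _] [/= ab [_ [v Vv <-] <-]]; apply: VU.
have {}ab : `|b - a| < d by rewrite distrC; move: ab; rewrite -ball_normE.
have [w Vw wx] : exists2 w, V w & r *: w = x.
  by apply: rV; rewrite gtr0_norm.
exists ((b - a) *: x + b *: (c *: v)); last first.
  by rewrite addrA -scalerDl subrKC scalerDr.
rewrite -wx; rewrite !scalerA; apply: cV => //.
rewrite !normrM (gtr0_norm r0) (gtr0_norm c0).
have h1 : `|b - a| * r <= 2^-1.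
  rewrite -ler_pdivlMr// -invfM; exact: ltW.
have h2 : `|b| * c <= 2^-1.
  rewrite /c invfM mulrCA -[leRHS]mulr1 ler_pM2l ?invr_gt0// ler_pdivrMr// mul1r.
  by rewrite -[in leLHS](subrKC a b) (le_trans (ler_normD _ _))// lerD2l ltW.
by apply: le_trans (lerD h1 h2) _; rewrite half_half.
Qed.

Let born_top_convex : exists2 C : set_system (born_top B),
  (forall b, b \in C -> convex_set b) & basis C.
Proof.
exists [set U : set (born_top B) | open U /\ @convex_set K (born_top B) U].
  by move=> b; rewrite inE => -[].
split=> [b [] //|x U [V [cV bV VU]]].
exists (interior ([set x + v | v in V] : set (born_top B))); last first.
  by move=> y /interior_subset /VU.
split; last by exists V; split.
split; first exact: open_interior.
move=> y z l; rewrite !inE => -[V1 [c1 b1 s1]] [V2 [c2 b2 s2]].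
exists (V1 `&` V2); split.
- by move=> a b p q ab [? ?] [? ?]; split; [exact: c1|exact: c2].
- by move=> A BA; apply: absorbsI; [exact: b1|exact: b2].
move=> _ [v [V1v V2v] <-].
have [p Vp py] : [set x + v | v in V] (y + v) by apply: s1; exists v.
have [q Vq qz] : [set x + v | v in V] (z + v) by apply: s2; exists v.
have l01 : l%:num + (1 - l%:num) = 1 :> K by rewrite subrKC.
exists (l%:num *: p + (1 - l%:num) *: q).
  apply: cV => //.
  by rewrite (@ger0_norm _ l%:num)// (@ger0_norm _ (1 - l%:num)) ?subr_ge0// l01.
have -> : p = y + (v - x) by rewrite addrA -py addrC addKr.
have -> : q = z + (v - x) by rewrite addrA -qz addrC addKr.
rewrite (scalerDr _ y) (scalerDr _ z) addrACA -scalerDl l01 scale1r.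
rewrite addrCA subrKC.
by [].
Qed.

(** This factory only builds the uniform structure; the three instances after
    it complete the [tvsType]. *)
HB.instance Definition _ := PreTopologicalLmod_isTvs.Build K (born_top B)
  born_top_add born_top_scale born_top_convex.
HB.instance Definition _ := PreTopologicalNmodule_isTopologicalNmodule.Build
  (born_top B) born_top_add.
HB.instance Definition _ := TopologicalNmodule_isTopologicalLmodule.Build
  K (born_top B) born_top_scale.
HB.instance Definition _ := Uniform_isTvs.Build K (born_top B) born_top_convex.

End BornTop.

Section VonNeumann.
Context {K : numFieldType} {E : tvsType K}.
Implicit Types (A C U : set E).

Definition tvs_bounded A : Prop := forall U, nbhs (0 : E) U -> absorbs U A.

Let convexP (V : set E) (l : K) (x y : E) : convex_set V ->
  0 <= l -> l <= 1 -> V x -> V y -> V (l *: x + (1 - l) *: y).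
Proof.
move=> cV l0 l1 Vx Vy.
by have := cV x y (Itv01 l0 l1); rewrite !inE; exact.
Qed.

Lemma nbhs0_abs_convex U : nbhs (0 : E) U ->
  exists W, [/\ nbhs (0 : E) W, abs_convex W & W `<=` U].
Proof.
have [C cC [oC bC]] := @locally_convex K E.
move=> /bC[V [CV V0] VU].
have {}cV : convex_set V by apply: cC; rewrite inE.
have nV : nbhs ((0 : K) *: (0 : E)) V.
  by rewrite scale0r; apply: open_nbhs_nbhs; split=> //; exact: oC.
have [[P N] /= [P0 N0] PN] := @scale_continuous K E (0, 0) V nV.
have [d /= d0 dP] := P0.
exists [set x | forall a : K, `|a| <= 1 -> V (a *: x)]; split.
- have d20 : 0 < d / 2 by rewrite divr_gt0.
  apply: filterS (@nbhs0Z _ _ N (d / 2) _ N0); last by rewrite gt_eqF.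
  move=> _ [y Ny <-] a a1; rewrite scalerA; apply: (PN (_, _)); split=> //=.
  apply: dP => /=; rewrite sub0r normrN normrM (gtr0_norm d20).
  apply: (@le_lt_trans _ _ (d / 2)); first by rewrite ler_piMl// ltW.
  by rewrite ltr_pdivrMr// ltr_pMr// ltr1n.
- move=> a b x y ab hx hy c c1.
  have [s0|s0] := eqVneq (`|a| + `|b|) 0.
    move/eqP: s0; rewrite paddr_eq0// !normr_eq0 => /andP[/eqP -> /eqP ->].
    by rewrite !scale0r addr0 scaler0.
  have sp : 0 < `|a| + `|b| by rewrite lt_neqAle eq_sym s0 addr_ge0.
  pose s := `|a| + `|b|; rewrite -/s in ab s0 sp.
  have key (z : K) : c * z = (`|z| / s) * (c * z * s / `|z|).
    have [->|z0] := eqVneq z 0; first by rewrite normr0 !(mul0r, mulr0).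
    have nz : `|z| != 0 by rewrite normr_eq0.
    by rewrite mulf_div mulrC (mulrC s) -mulf_div divff// mul1r mulfK.
  have bnd (z : K) : `|c * z * s / `|z| | <= 1.
    have [->|z0] := eqVneq z 0; first by rewrite normr0 !(mul0r, mulr0) normr0.
    have nz : `|z| != 0 by rewrite normr_eq0.
    rewrite !normrM normfV normr_id (mulrAC `|c|) mulfK// (gtr0_norm sp).
    by rewrite mulr_ile1// ltW.
  rewrite scalerDr !scalerA (key a) (key b) -[X in V (X + _)]scalerA -[X in V (_ + X)]scalerA.
  have -> : `|b| / s = 1 - `|a| / s.
    by apply/eqP; rewrite eq_sym subr_eq -mulrDl addrC divff.
  apply: convexP => //.
  + by rewrite divr_ge0// ltW.
  + by rewrite ler_pdivrMr// mul1r lerDl.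
  + by apply: hx.
  + by apply: hy.
- by move=> x /(_ 1); rewrite normr1 scale1r => /(_ (lexx _)) /VU.
Qed.

Let tvs_bounded_cover (x : E) : exists2 A, tvs_bounded A & A x.
Proof.
exists [set x] => // U U0.
have [W [W0 cW WU]] := nbhs0_abs_convex U0.
have nW : nbhs ((0 : K) *: x) W by rewrite scale0r.
have [[P N] /= [P0 Nx] PN] := @scale_continuous K E (0, x) W nW.
have [d /= d0 dP] := P0.
exists (2 / d); first by rewrite divr_gt0.
move=> a da _ ->.
have a0 : a != 0 by rewrite -normr_gt0; apply: lt_le_trans da; rewrite divr_gt0.
exists (a^-1 *: x); last by rewrite scalerA divff// scale1r.
apply: WU; apply: (PN (_, _)); split; last exact: nbhs_singleton.
apply: dP => /=; rewrite sub0r normrN normfV invf_plt ?posrE ?normr_gt0//.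
by apply: lt_le_trans da; rewrite ltr_pMl ?invr_gt0// ltr1n.
Qed.

Let tvs_bounded_sub A C : A `<=` C -> tvs_bounded C -> tvs_bounded A.
Proof.
move=> AC bC U U0; have [r r0 rU] := bC U U0.
by exists r => // a ra x /AC; exact: rU.
Qed.

Let tvs_boundedU A C : tvs_bounded A -> tvs_bounded C -> tvs_bounded (A `|` C).
Proof.
move=> bA bC U U0; have [r r0 rU] := bA U U0; have [s s0 sU] := bC U U0.
exists (r + s); first exact: addr_gt0.
move=> a rsa x [Ax|Cx]; [apply: rU|apply: sU] => //.
  by apply: le_trans rsa; rewrite lerDl ltW.
by apply: le_trans rsa; rewrite lerDr ltW.
Qed.

Let tvs_boundedD A C : tvs_bounded A -> tvs_bounded C ->
  tvs_bounded [set x + y | x in A & y in C].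
Proof.
move=> bA bC U U0; have [W [W0 cW WU]] := nbhs0_abs_convex U0.
have half0 : 2^-1 != 0 :> K by rewrite invr_eq0 pnatr_eq0.
have W20 : nbhs (0 : E) [set 2^-1 *: w | w in W] by exact: nbhs0Z.
have [r r0 rU] := bA _ W20; have [s s0 sU] := bC _ W20.
exists (r + s); first exact: addr_gt0.
move=> a rsa _ [x Ax [y Cy <-]].
have ra : r <= `|a| by apply: le_trans rsa; rewrite lerDl ltW.
have sa : s <= `|a| by apply: le_trans rsa; rewrite lerDr ltW.
have [_ [v Wv <-] <-] := rU a ra x Ax; have [_ [w Ww <-] <-] := sU a sa y Cy.
exists (2^-1 *: v + 2^-1 *: w); last by rewrite scalerDr.
by apply/WU/cW => //; rewrite ger0_norm ?invr_ge0// half_half.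
Qed.

Let tvs_boundedZ (c : K) A : tvs_bounded A -> tvs_bounded [set c *: x | x in A].
Proof.
move=> bA U U0; have [c0|c0] := eqVneq c 0.
  exists 1 => // a a1 _ [x _ <-]; exists 0; first exact: nbhs_singleton.
  by rewrite c0 scale0r scaler0.
have [r r0 rU] := bA _ U0.
have nc : 0 < `|c| by rewrite normr_gt0.
exists (r * `|c|); first exact: mulr_gt0.
move=> a ra _ [x Ax <-].
have [|u Uu <-] := rU (a / c) _ x Ax; first by rewrite normrM normfV ler_pdivlMr.
by exists u => //; rewrite scalerA mulrCA divff// mulr1.
Qed.

Let tvs_bounded_hull A : tvs_bounded A -> tvs_bounded (abs_convex_hull A).
Proof.
move=> bA U U0; have [W [W0 cW WU]] := nbhs0_abs_convex U0.
have [r r0 rW] := bA _ W0.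
exists r => // a ra x /(_ [set a *: w | w in W])[|w Ww <-].
  by split; [exact: abs_convex_scale|exact: rW].
by exists w => //; exact: WU.
Qed.

(** [(E, tau)^b]. *)
Definition tvs_bornology : bornology E :=
  Bornology tvs_bounded_cover tvs_bounded_sub tvs_boundedU tvs_boundedD
    tvs_boundedZ tvs_bounded_hull.

End VonNeumann.
Arguments tvs_bornology {K} E.

Record banach_sequence (K : numFieldType) := BanachSequence {
  step :> nat -> completeNormedModType K;
  link : forall n, {linear step n -> step n.+1};
  link_continuous : forall n, continuous (link n);
  link_injective : forall n, injective (link n)
}.

Section Colimits.
Context {K : numFieldType} (X : banach_sequence K).

Definition cocone (E : lmodType K) (g : forall n, {linear X n -> E}) : Prop :=
  forall n x, g n.+1 (link X n x) = g n x.

(** [E] with the maps [g n] is a colimit of [X] in [Tc]. *)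
Definition Tc_colimit (E : tvsType K) (g : forall n, {linear X n -> E}) :
    Prop :=
  [/\ forall n, continuous (g n), cocone g &
      forall (F : tvsType K) (h : forall n, {linear X n -> F}),
        (forall n, continuous (h n)) -> cocone h ->
        exists u : {linear E -> F},
          [/\ continuous u, forall n x, u (g n x) = h n x &
              forall v : {linear E -> F}, continuous v ->
                (forall n x, v (g n x) = h n x) -> v =1 u]].

(** [(E, B)] with the maps [g n] is a colimit of the [(X n)^b] in [Born]. *)
Definition Born_colimit (E : lmodType K) (B : bornology E)
    (g : forall n, {linear X n -> E}) : Prop :=
  [/\ forall n, bounded_map (tvs_bornology (X n)) B (g n), cocone g &
      forall (F : lmodType K) (C : bornology F) (h : forall n, {linear X n -> F}),
        (forall n, bounded_map (tvs_bornology (X n)) C (h n)) -> cocone h ->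
        exists u : {linear E -> F},
          [/\ bounded_map B C u, forall n x, u (g n x) = h n x &
              forall v : {linear E -> F}, bounded_map B C v ->
                (forall n x, v (g n x) = h n x) -> v =1 u]].

End Colimits.

Section Categories.
Context {K : numFieldType}.

(** The isomorphism between [E^b] and the colimit of the [(X n)^b] is the
    canonical one, induced by the cocone that presents [E]. *)
Definition regular_LB_space (E : tvsType K) : Prop :=
  exists (X : banach_sequence K) (g : forall n, {linear X n -> E}),
    Tc_colimit g /\ Born_colimit (tvs_bornology E) g.

Definition NBorn (E : lmodType K) (B : bornology E) : Prop :=
  forall A : set E, tvs_bornology (born_top B) A <-> B A.

Definition bLB (E : lmodType K) (B : bornology E) : Prop :=
  exists2 F : tvsType K, regular_LB_space F & born_iso B (tvs_bornology F).

Definition LBb (E : lmodType K) (B : bornology E) : Prop :=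
  exists (X : banach_sequence K) (g : forall n, {linear X n -> E}),
    Born_colimit B g.

End Categories.

Section BanachDisks.
Context {K : numFieldType} {E : lmodType K}.
Implicit Types (A D : set E) (B : bornology E).

(** The subspace [E_D]. *)
Definition disk_span D : set E :=
  [set x | exists (n : nat) (a : 'I_n -> K) (d : 'I_n -> E),
     (forall i, D (d i)) /\ x = \sum_(i < n) a i *: d i].

(** When [K] is [R[i]] this is the real infimum, embedded in [R[i]]. *)
Definition minkowski D (x : E) : K :=
  infimum 0 [set l : K | 0 < l /\ [set l *: d | d in D] x].

Definition banach_disk D : Prop :=
  [/\ D !=set0, abs_convex D,
      (forall x, disk_span D x -> minkowski D x = 0 -> x = 0) &
      forall u : nat -> E, (forall i, disk_span D (u i)) ->
        (forall e : K, 0 < e -> exists N, forall i j,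
          (N <= i)%N -> (N <= j)%N -> minkowski D (u i - u j) < e) ->
        exists2 x, disk_span D x & forall e : K, 0 < e -> exists N, forall i,
          (N <= i)%N -> minkowski D (u i - x) < e].

(** [A] is a bounded subset of the seminormed space [E_D]. *)
Definition disk_bounded D A : Prop :=
  A `<=` disk_span D /\ exists M : K, forall x, A x -> minkowski D x <= M.

Definition disk_colimit B (D : nat -> set E) : Prop :=
  [/\ forall n A, disk_bounded (D n) A -> disk_bounded (D n.+1) A,
      forall x, exists n, disk_span (D n) x &
      forall A, B A <-> exists n, disk_bounded (D n) A].

Definition functionals_separate (D : nat -> set E) : Prop :=
  forall e : E, e != 0 -> exists2 f : {scalar E}, f e != 0 &
    forall n, exists M : K, forall b, D n b -> `|f b| <= M.

Definition closures_bounded B (D : nat -> set E) : Prop :=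
  forall n, exists2 m, (n <= m)%N &
    disk_bounded (D m) (closure (D n : set (born_top B))).

End BanachDisks.

(* Main.v *)
From HB Require Import structures.
Require Import Defs.
From mathcomp Require Import all_boot all_order all_algebra.
From mathcomp Require Import complex.
From mathcomp Require Import all_classical all_reals all_analysis.
From mathcomp Require Import ring lra.

Set Implicit Arguments.
Unset Strict Implicit.
Unset Printing Implicit Defensive.

Import Order.TTheory GRing.Theory Num.Theory.
Import numFieldNormedType.Exports.

Local Open Scope classical_set_scope.
Local Open Scope ring_scope.

Local Notation minkowski := Defs.minkowski.

(** Everything goes through the identity bLB = LBb /\ NBorn, and for a colimit
    of Banach disks through the equivalence of NBorn with the two conditions.

    The identity is formal. The functor [born_top] is left adjoint to
    [tvs_bornology], so the bornology of any locally convex space is in [NBorn]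
    ([tvs_bornology_NBorn]), and a presentation of a regular LB-space shows that
    its bornology is in [LBb]. Conversely let [B] be a [Born]-colimit of Banach
    spaces. A Banach space is bornological: a linear map out of it is continuous
    as soon as it sends bounded sets to bounded sets
    ([normed_bounded_continuous]). Hence [born_top B] is the [Tc]-colimit of the
    same sequence, and for [B] in [NBorn] it has the bounded sets of [B], which
    makes it regular ([LBb_NBorn_bLB]).

    Let now [B] be the colimit of the disks [D n]. It lies in [LBb], the spaces
    [E_(D n)] being Banach spaces with bounded injective inclusions
    ([disk_colimit_LBb]).

    If [B] is in [NBorn], then closures of bounded sets are bounded, which is
    the closure condition. Moreover every [e != 0] is missed by some bornivorous
    absolutely convex [V]: otherwise the line through [e] would be bounded for
    the topology, hence bounded in some [E_(D n)], where [minkowski] is a norm.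
    The Hahn-Banach theorem for the gauge of [V] then gives a functional that
    does not vanish at [e] and is bounded on all sets that [V] absorbs
    ([NBorn_functionals_separate]).

    If closures of bounded sets are bounded, [B] is in [NBorn] by a gliding hump
    ([countable_base_NBorn]). Let [T k] be an increasing sequence of absolutely
    convex sets cofinal in [B], and suppose that [A] is bounded for the topology
    but not in [B]. For each [k] the set [A] has a point [x k] whose multiple
    [y k = x k / (k + 1)] is outside the closure of [T k], so that [y k] is not
    in [T k + W k] for some bornivorous [W k]. The intersection [V] of the sets
    [T k + W k] is again bornivorous, because [T j] is contained in all of them
    but the first [j]; and [V] contains no [y k], so it does not absorb [A].

    The real and the complex case differ only in two facts on the scalars:
    the existence of infima of sets of positive elements ([positive_infima])
    and the extension of functionals ([seminorm_extension]). *)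

(** * Absorption, linear maps and the topology of a bornology *)

(** Used to move a linear map along the identity between [E] and [born_top B]:
    the operations are convertible, the two module structures are not. *)
Definition mk_linear (K : numFieldType) (U V : lmodType K) (f : U -> V)
    (lf : linear f) : {linear U -> V} :=
  HB.pack f (GRing.isLinear.Build K U V *:%R f lf).

Section Absorption.
Context {K : numFieldType}.
Implicit Types (E F : lmodType K).

Lemma absorbs_preimage E F (u : {linear E -> F}) (V : set F) (A : set E) :
  absorbs V [set u x | x in A] -> absorbs (u @^-1` V) A.
Proof.
move=> [r r0 rV]; exists r => // a ra x Ax.
have a0 : a != 0 by rewrite -normr_gt0; apply: lt_le_trans ra.
have [|v Vv vx] := rV a ra (u x); first by exists x.
exists (a^-1 *: x); last by rewrite scalerA divff// scale1r.
by rewrite /= linearZ/= -vx scalerA mulVf// scale1r.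
Qed.

Lemma absorbs_image E F (u : {linear E -> F}) (V : set F) (A : set E) :
  absorbs (u @^-1` V) A -> absorbs V [set u x | x in A].
Proof.
move=> [r r0 rV]; exists r => // a ra _ [x Ax <-].
have [v Vv <-] := rV a ra x Ax.
by exists (u v) => //; rewrite linearZ.
Qed.

Lemma abs_convex_preimage E F (u : {linear E -> F}) (V : set F) :
  abs_convex V -> abs_convex (u @^-1` V).
Proof.
by move=> cV a b x y ab Vx Vy; rewrite /= linearP linearZ; exact: cV.
Qed.

Lemma abs_convexI E (I : Type) (V : I -> set E) :
  (forall i, abs_convex (V i)) -> abs_convex (\bigcap_i V i).
Proof.
by move=> cV a b x y ab Vx Vy i _; apply: cV => //; [exact: Vx|exact: Vy].
Qed.

Lemma absorbs_superset E (V W A : set E) :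
  V `<=` W -> absorbs V A -> absorbs W A.
Proof.
by move=> VW [r r0 rV]; exists r => // a ra x /(rV a ra)[v /VW]; exists v.
Qed.

Lemma absorbs_subset E (V A C : set E) :
  A `<=` C -> absorbs V C -> absorbs V A.
Proof. by move=> AC [r r0 rV]; exists r => // a ra x /AC; exact: rV. Qed.

Lemma born_top_nbhs0P E (B : bornology E) (U : set (born_top B)) :
  nbhs (0 : born_top B) U <->
  exists V : set E, [/\ abs_convex V, bornivorous B V & V `<=` U].
Proof.
split=> -[V [cV bV VU]]; exists V; split=> //.
  by move=> v Vv; apply: VU; exists v => //; rewrite add0r.
by move=> _ [v Vv <-]; rewrite add0r; exact: VU.
Qed.

Lemma tvs_bornologyE (E : tvsType K) (A : set E) :
  tvs_bornology E A = tvs_bounded A.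
Proof. by []. Qed.

Lemma bounded_sets_tvs_bounded E (B : bornology E) (A : set E) :
  B A -> tvs_bornology (born_top B) A.
Proof.
rewrite tvs_bornologyE => BA U /born_top_nbhs0P[V [_ bV VU]].
exact: absorbs_superset VU (bV A BA).
Qed.

Lemma linear_continuous0 (E F : tvsType K) (u : {linear E -> F}) :
  (forall U, nbhs (0 : F) U -> nbhs (0 : E) (u @^-1` U)) -> continuous u.
Proof.
move=> u0 x U Ux.
have /u0/(nbhsT x) : nbhs (0 : F) [set - u x + v | v in U].
  by rewrite -(addNr (u x)); apply: nbhsB.
apply: filterS => _ [y [v Uv yv] <-] /=.
by rewrite linearD -yv addNKr.
Qed.

Lemma continuous_bounded_map (E F : tvsType K) (u : {linear E -> F}) :
  continuous u -> bounded_map (tvs_bornology E) (tvs_bornology F) u.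
Proof.
rewrite /bounded_map => cu A; rewrite !tvs_bornologyE => bA U U0.
apply: absorbs_image; apply: bA.
by apply: cu; rewrite linear0.
Qed.

(** Preimages of absolutely convex neighbourhoods under a bounded map are
    bornivorous: [born_top] is left adjoint to [tvs_bornology]. *)
Lemma born_top_continuous E (B : bornology E) (F : tvsType K)
    (u : {linear born_top B -> F}) :
  bounded_map B (tvs_bornology F) u -> continuous u.
Proof.
move=> bu; apply: linear_continuous0 => U U0; apply/born_top_nbhs0P.
have [W [W0 cW WU]] := nbhs0_abs_convex U0.
exists (u @^-1` W); split.
- exact: abs_convex_preimage.
- by move=> A /bu bA; exact/absorbs_preimage/bA.
- by move=> x; exact: WU.
Qed.

Lemma normed_boundedP (V : normedModType K) (A : set V) :
  tvs_bornology V A <-> exists2 M : K, 0 < M & forall x, A x -> `|x| <= M.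
Proof.
rewrite tvs_bornologyE; split=> [bA|[M M0 AM] U /nbhs_ballP[e /= e0 eU]].
  have [r r0 rA] := bA _ (nbhsx_ballx (0 : V) 1 ltr01).
  exists r => // x Ax; have := rA r; rewrite gtr0_norm// => /(_ (lexx _) x Ax).
  move=> [v]; rewrite -ball_normE/= sub0r normrN => v1 <-.
  by rewrite normrZ gtr0_norm// ler_piMr// ltW.
have M10 : 0 < M + 1 by rewrite addr_gt0.
exists ((M + 1) / e); first exact: divr_gt0.
move=> a ra x Ax.
have na : 0 < `|a| by apply: lt_le_trans ra; exact: divr_gt0.
exists (a^-1 *: x); last by rewrite scalerA divff ?scale1r// -normr_gt0.
apply: eU; rewrite -ball_normE/= sub0r normrN normrZ normfV mulrC ltr_pdivrMr//.
apply: le_lt_trans (AM _ Ax) _; apply: (@lt_le_trans _ _ (M + 1)).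
  by rewrite ltrDl.
by rewrite -ler_pdivrMl// mulrC.
Qed.

(** A normed space is bornological: if a neighbourhood of [0] absorbs the image
    of the unit ball with constant [r], its preimage contains the ball of radius
    [r^-1]. *)
Lemma normed_bounded_continuous (V : normedModType K) (F : tvsType K)
    (u : {linear V -> F}) :
  bounded_map (tvs_bornology V) (tvs_bornology F) u -> continuous u.
Proof.
move=> bu; apply: linear_continuous0 => U U0.
have : tvs_bornology V (ball 0 1).
  apply/normed_boundedP; exists 1 => // x; rewrite -ball_normE/= sub0r normrN.
  exact: ltW.
move=> /bu/(_ U U0)[r r0 rU]; apply/nbhs_ballP; exists r^-1 => /=.
  by rewrite invr_gt0.
move=> x; rewrite -ball_normE/= sub0r normrN => xr.
have [||w Uw wx] := rU r _ (u (r *: x)); first by rewrite gtr0_norm.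
  exists (r *: x) => //; rewrite -ball_normE/= sub0r normrN normrZ gtr0_norm//.
  by rewrite mulrC -ltr_pdivlMr// mul1r.
have <- : w = u x by apply: (scalerI (lt0r_neq0 r0)); rewrite wx linearZ.
by [].
Qed.

Lemma normed_born_top_continuous (V : normedModType K) E (B : bornology E)
    (u : {linear V -> born_top B}) :
  bounded_map (tvs_bornology V) B u -> continuous u.
Proof.
move=> bu; apply: normed_bounded_continuous => A /bu.
exact: bounded_sets_tvs_bounded.
Qed.

End Absorption.

(** * The identity between bLB and the intersection of LBb and NBorn *)

Section Categories.
Context {K : numFieldType}.
Implicit Types (E F : lmodType K).

Lemma NBorn_born_iso E F (B : bornology E) (C : bornology F) :
  born_iso B C -> NBorn C -> NBorn B.
Proof.
move=> [u [v [bu bv uK vK]]] NC A; split; last exact: bounded_sets_tvs_bounded.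
rewrite tvs_bornologyE => bA; have : C [set u x | x in A].
  apply/NC; rewrite tvs_bornologyE => U /born_top_nbhs0P[V [cV bV VU]].
  apply: absorbs_superset VU _; apply: absorbs_image; apply: bA.
  apply/born_top_nbhs0P; exists (u @^-1` V); split=> //.
    exact: abs_convex_preimage.
  by move=> A' /bu/bV; exact: absorbs_preimage.
move=> /bv; apply: bornology_sub => x Ax; exists (u x); last by rewrite uK.
by exists x.
Qed.

Lemma bounded_map_comp E F (G : lmodType K) (B : bornology E)
    (C : bornology F) (D : bornology G) (u : E -> F) (v : F -> G) :
  bounded_map B C u -> bounded_map C D v -> bounded_map B D (v \o u).
Proof. by move=> bu bv A /bu/bv; rewrite image_comp. Qed.

Lemma Born_colimit_iso (X : banach_sequence K) E F (B : bornology E)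
    (C : bornology F) (g : forall n, {linear X n -> F}) :
  born_iso B C -> Born_colimit C g ->
  exists g' : forall n, {linear X n -> E}, Born_colimit B g'.
Proof.
move=> [u [v [bu bv uK vK]]] [bg cg univ].
exists (fun n => (v \o g n : {linear X n -> E})); split.
- by move=> n; exact: bounded_map_comp (bg n) bv.
- by move=> n x /=; rewrite cg.
move=> G D h bh ch; have [w [bw wh wu]] := univ G D h bh ch.
exists (w \o u : {linear E -> G}); split.
- exact: bounded_map_comp bu bw.
- by move=> n x /=; rewrite vK.
move=> w' bw' w'h x /=.
rewrite -(wu (w' \o v : {linear F -> G})) /= ?uK//.
exact: bounded_map_comp bv bw'.
Qed.

(** The topology of [born_top (tvs_bornology F)] is finer than that of [F], so
    it has no more bounded sets. *)
Lemma tvs_bornology_NBorn (F : tvsType K) : NBorn (tvs_bornology F).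
Proof.
move=> A; split; last exact: bounded_sets_tvs_bounded.
rewrite !tvs_bornologyE => bA U U0; apply: bA.
pose i := mk_linear (f := idfun : born_top (tvs_bornology F) -> F)
  (fun _ _ _ => erefl).
have ci : continuous i by apply: born_top_continuous => C; rewrite image_id.
exact: (ci 0 U U0).
Qed.

Lemma bLB_LBb_NBorn E (B : bornology E) : bLB B -> LBb B /\ NBorn B.
Proof.
move=> [F rF BF]; split; last first.
  exact: NBorn_born_iso BF (@tvs_bornology_NBorn F).
have [X [g [_ cF]]] := rF; exists X.
exact: Born_colimit_iso BF cF.
Qed.

(** The functor [born_top], being a left adjoint, preserves colimits; [NBorn]
    serves to see the [g n] as bounded maps into [B] itself. *)
Lemma Born_colimit_Tc_colimit (X : banach_sequence K) E (B : bornology E)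
    (g : forall n, {linear X n -> born_top B}) :
  NBorn B -> Born_colimit (tvs_bornology (born_top B)) g -> Tc_colimit g.
Proof.
move=> NB [bg cg univ]; split=> //.
  move=> n; apply: normed_born_top_continuous => A /(bg n) bA; exact/NB.
move=> F h ch coh.
have [||u [bu uh uu]] := univ F (tvs_bornology F) h; last 1 first.
- exists u; split=> //.
    by apply: born_top_continuous => A /bounded_sets_tvs_bounded/bu.
  by move=> v cv vh; apply: uu => //; exact: continuous_bounded_map.
- by move=> n; exact/continuous_bounded_map/ch.
- exact: coh.
Qed.

Lemma NBorn_iso E (B : bornology E) :
  NBorn B -> born_iso B (tvs_bornology (born_top B)).
Proof.
move=> NB.
exists (mk_linear (f := idfun : E -> born_top B) (fun _ _ _ => erefl)).
exists (mk_linear (f := idfun : born_top B -> E) (fun _ _ _ => erefl)).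
by split=> // A; rewrite image_id => /NB.
Qed.

Lemma born_iso_sym E F (B : bornology E) (C : bornology F) :
  born_iso B C -> born_iso C B.
Proof. by move=> [u [v [bu bv uK vK]]]; exists v, u. Qed.

Lemma LBb_NBorn_bLB E (B : bornology E) : LBb B -> NBorn B -> bLB B.
Proof.
move=> [X [g cg]] NB; exists (born_top B); last exact: NBorn_iso.
have [g' cg'] := Born_colimit_iso (born_iso_sym (NBorn_iso NB)) cg.
by exists X, g'; split=> //; exact: Born_colimit_Tc_colimit.
Qed.

End Categories.

(** * Gauges of absolutely convex sets *)

(** Order completeness in the form that [minkowski] requires. It is phrased for
    sets of positive elements because these are the sets on which the partial
    order of the complex numbers is that of the reals. *)
Definition positive_infima (K : numFieldType) : Prop :=
  forall S : set K, S !=set0 -> (forall l, S l -> 0 < l) -> infimums S !=set0.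

Section Minkowski.
Context {K : numFieldType} (Kinf : positive_infima K).

Lemma infimum_positive (S : set K) : S !=set0 -> (forall l, S l -> 0 < l) ->
  infimums S (infimum 0 S).
Proof.
move=> S0 S_gt0; have [i iS] := Kinf S0 S_gt0; rewrite /infimum.
case: ifPn => [/eqP S00|_]; first by move: S0; rewrite S00 => -[].
by case: xgetP => // /(_ i).
Qed.

(** The infimum [i] of the inverses of the positive integers satisfies
    [i * 2 <= i], so it is [0], and [x^-1] is not a lower bound of them. *)
Lemma positive_infima_archimedean (x : K) :
  0 < x -> exists n : nat, x < n.+1%:R.
Proof.
move=> x0; pose S : set K := [set n.+1%:R^-1 | n in [set: nat]].
have S_gt0 l : S l -> 0 < l by move=> [n _ <-]; rewrite invr_gt0.
have [i [iS Si]] : infimums S !=set0.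
  by apply: Kinf => //; exists (1%:R^-1); exists 0%N.
have i0 : 0 <= i by apply: Si => l /S_gt0/ltW.
have i2 : i * 2 <= i.
  apply: Si => _ [n _ <-]; rewrite -ler_pdivlMr// -invfM.
  rewrite -natrM; apply: iS; exists (n.+1 * 2).-1 => //.
have {i2}i00 : i <= 0 by move: i2; rewrite mulr_natr mulr2n gerDl.
apply: contrapT => nx.
have : x^-1 <= i.
  apply: Si => _ [n _ <-]; rewrite lef_pV2 ?posrE// real_leNgt ?gtr0_real//.
  by apply/negP => xn; apply: nx; exists n.
by move=> /le_trans/(_ i00); rewrite lt_geF// invr_gt0.
Qed.

Context {E : lmodType K}.
Implicit Types (D : set E).

Lemma abs_convex0 D : D !=set0 -> abs_convex D -> D 0.
Proof.
move=> [d Dd] cD; have := cD 0 0 d d.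
by rewrite !scale0r addr0; apply => //; rewrite normr0 addr0.
Qed.

Lemma abs_convexZ D (a : K) (x : E) :
  D !=set0 -> abs_convex D -> `|a| <= 1 -> D x -> D (a *: x).
Proof.
move=> D0 cD a1 Dx; have := cD a 0 x 0.
by rewrite scale0r addr0 normr0 addr0; apply => //; exact: abs_convex0.
Qed.

Lemma dilationZ D (a l m : K) (x : E) : D !=set0 -> abs_convex D ->
  0 < m -> `|a| * `|l| <= m ->
  [set l *: d | d in D] x -> [set m *: d | d in D] (a *: x).
Proof.
move=> D0 cD m0 alm [d Dd <-]; exists ((m^-1 * (a * l)) *: d).
  apply: abs_convexZ => //; rewrite !normrM normfV (gtr0_norm m0).
  by rewrite ler_pdivrMl// mulr1.
by rewrite !scalerA mulVKf// gt_eqF.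
Qed.

Lemma dilation_le D (l m : K) (x : E) : D !=set0 -> abs_convex D ->
  0 < m -> `|l| <= m ->
  [set l *: d | d in D] x -> [set m *: d | d in D] x.
Proof.
move=> D0 cD m0 lm lx; rewrite -(scale1r x).
by apply: dilationZ lx => //; rewrite normr1 mul1r.
Qed.

(** This is the convexity inequality behind the subadditivity of the gauge:
    [l d + m d'] is [l + m] times the convex combination of [d] and [d'] with
    weights [l / (l + m)] and [m / (l + m)]. *)
Lemma dilationD D (l m : K) (x y : E) : abs_convex D -> 0 < l -> 0 < m ->
  [set l *: d | d in D] x -> [set m *: d | d in D] y ->
  [set (l + m) *: d | d in D] (x + y).
Proof.
move=> cD l0 m0 [d Dd <-] [d' Dd' <-].
have lm0 : 0 < l + m by exact: addr_gt0.
exists ((l / (l + m)) *: d + (m / (l + m)) *: d').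
  apply: cD => //; rewrite !gtr0_norm ?divr_gt0//.
  by rewrite -mulrDl divff// gt_eqF.
by rewrite scalerDr !scalerA !(mulrCA (l + m)) divff ?mulr1// gt_eqF.
Qed.

Lemma disk_span_submod_closed D :
  submod_closed [pred x : E | x \in disk_span D].
Proof.
split.
  rewrite !inE; exists 0%N, (fun=> 0), (fun=> 0).
  by split; [case|rewrite big_ord0].
move=> a x y; rewrite !inE => -[n [b [d [Dd ->]]]] [m [c [e [De ->]]]].
exists (n + m)%N.
exists (fun i : 'I_(n + m) =>
  match fintype.split i with inl j => a * b j | inr j => c j end).
exists (fun i : 'I_(n + m) =>
  match fintype.split i with inl j => d j | inr j => e j end).
split; first by move=> i; case: (fintype.split i).
rewrite big_split_ord/= scaler_sumr; congr (_ + _); apply: eq_bigr => i _.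
  by rewrite (unsplitK (inl _ i)) scalerA.
by rewrite (unsplitK (inr _ i)).
Qed.

Lemma disk_span_mem D x : D x -> disk_span D x.
Proof.
move=> Dx; exists 1%N, (fun=> 1), (fun=> x); split=> //.
by rewrite big_ord1 scale1r.
Qed.

Lemma disk_spanP D x : D !=set0 -> abs_convex D ->
  disk_span D x <-> exists2 l : K, 0 < l & [set l *: d | d in D] x.
Proof.
move=> D0 cD; split=> [[n [a [d [Dd ->]]]]|[l l0 [d Dd <-]]]; last first.
  by exists 1%N, (fun=> l), (fun=> d); split=> //; rewrite big_ord1.
elim: n a d Dd => [|n IHn] a d Dd.
  exists 1 => //; exists 0; first exact: abs_convex0.
  by rewrite big_ord0 scaler0.
rewrite big_ord_recl.
have [l l0 xl] := IHn (a \o lift ord0) (d \o lift ord0) (fun i => Dd _).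
have a0 : 0 < `|a ord0| + 1 by rewrite ltr_wpDl.
exists (`|a ord0| + 1 + l); first exact: addr_gt0.
apply: dilationD => //; apply: (@dilationZ D _ 1) => //.
  by rewrite normr1 mulr1 lerDl.
by exists (d ord0) => //; rewrite scale1r.
Qed.

Section Disk.
Variable D : set E.
Hypotheses (D0 : D !=set0) (cD : abs_convex D).

Let mink_inf x : disk_span D x ->
  infimums [set l : K | 0 < l /\ [set l *: d | d in D] x] (minkowski D x).
Proof.
move=> /(disk_spanP _ D0 cD)[l l0 lx].
by apply: infimum_positive => [|m []//]; exists l.
Qed.

Lemma minkowski_le (l : K) x : 0 < l -> [set l *: d | d in D] x ->
  minkowski D x <= l.
Proof.
move=> l0 lx; have /mink_inf[+ _] : disk_span D x; last exact.
by apply/disk_spanP => //; exists l.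
Qed.

(** The infimum is the greatest lower bound, also for the partial order of the
    complex numbers; this replaces approximation arguments below. *)
Lemma le_minkowski (m : K) x : disk_span D x ->
  (forall l, 0 < l -> [set l *: d | d in D] x -> m <= l) -> m <= minkowski D x.
Proof.
by move=> /mink_inf[_ xD] ml; apply: xD => l -[]; exact: ml.
Qed.

Lemma minkowski_ge0 x : disk_span D x -> 0 <= minkowski D x.
Proof. by move=> Dx; apply: le_minkowski => // l /ltW. Qed.

Lemma minkowski_lt (l : K) x : disk_span D x -> minkowski D x < l ->
  [set l *: d | d in D] x.
Proof.
move=> Dx xl; have l0 := le_lt_trans (minkowski_ge0 Dx) xl.
have [m [m0 ml mx]] : exists m, [/\ 0 < m, m <= l & [set m *: d | d in D] x].
  apply: contrapT => nm; have := lt_geF xl; rewrite le_minkowski// => m m0 mx.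
  rewrite real_leNgt ?gtr0_real//; apply/negP => ml.
  by apply: nm; exists m; rewrite ltW.
by apply: dilation_le mx => //; rewrite gtr0_norm.
Qed.

Lemma disk_spanZ a x : disk_span D x -> disk_span D (a *: x).
Proof.
move=> /mem_set Dx; rewrite -[_ *: _]addr0; apply/set_mem.
have [span0 spanD] := disk_span_submod_closed D; exact: spanD.
Qed.

Lemma minkowskiD x y : disk_span D x -> disk_span D y ->
  minkowski D (x + y) <= minkowski D x + minkowski D y.
Proof.
move=> Dx Dy; rewrite -lerBlDr; apply: le_minkowski => // l l0 lx.
rewrite lerBlDr -lerBlDl; apply: le_minkowski => // m m0 my.
by rewrite lerBlDl; apply: minkowski_le; [exact: addr_gt0|exact: dilationD].
Qed.

Lemma minkowski0 : minkowski D 0 = 0.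
Proof.
have D00 : disk_span D 0 by apply: disk_span_mem; exact: abs_convex0.
apply/eqP; rewrite eq_le minkowski_ge0// andbT.
have m2 : minkowski D 0 * 2 <= minkowski D 0.
  apply: le_minkowski => // l l0 _; rewrite -ler_pdivlMr//.
  apply: minkowski_le; first by rewrite divr_gt0.
  by exists 0; [exact: abs_convex0|rewrite scaler0].
by move: m2; rewrite mulr_natr mulr2n gerDl.
Qed.

Lemma minkowskiZ a x : disk_span D x ->
  minkowski D (a *: x) = `|a| * minkowski D x.
Proof.
have le_mZ b y : b != 0 -> disk_span D y ->
    minkowski D (b *: y) <= `|b| * minkowski D y.
  move=> b0 Dy; rewrite -ler_pdivrMl ?normr_gt0//.
  apply: le_minkowski => // l l0 ly; rewrite ler_pdivrMl ?normr_gt0//.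
  have bl : 0 < `|b| * l by rewrite mulr_gt0// normr_gt0.
  apply: minkowski_le => //; apply: dilationZ ly => //.
  by rewrite (gtr0_norm l0).
have [->|a0] := eqVneq a 0; first by rewrite scale0r normr0 mul0r minkowski0.
move=> Dx; apply/eqP; rewrite eq_le le_mZ//=.
rewrite -ler_pdivlMl ?normr_gt0// -normfV.
apply: le_trans (le_mZ _ _ _ _); rewrite ?invr_eq0//; last exact: disk_spanZ.
by rewrite scalerA mulVf// scale1r.
Qed.

Lemma minkowski_le1 x : D x -> minkowski D x <= 1.
Proof.
by move=> Dx; apply: minkowski_le => //; exists x => //; rewrite scale1r.
Qed.

End Disk.
End Minkowski.

(** * The Banach space spanned by a Banach disk *)

Section DiskSpace.
Context {K : numFieldType} {E : lmodType K}.

Definition disk_pred (D : set E) : {pred E} := [pred x | x \in disk_span D].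

HB.instance Definition _ (D : set E) :=
  GRing.isSubmodClosed.Build K E (disk_pred D) (disk_span_submod_closed D).

Record disk_space (D : set E) :=
  DiskSpace { disk_val : E; _ : disk_val \in disk_pred D }.

HB.instance Definition _ (D : set E) := [isSub for @disk_val D].
HB.instance Definition _ (D : set E) := [Choice of disk_space D by <:].
HB.instance Definition _ (D : set E) :=
  [SubChoice_isSubLmodule of disk_space D by <:].

Lemma disk_valP (D : set E) (x : disk_space D) : disk_span D (val x).
Proof. by apply/set_mem; exact: (valP x). Qed.

(** A separate alias carries the norm, since the norm axioms depend on the
    completeness of the scalars and on [D] being a Banach disk. *)
Definition normed_disk_space (Kinf : positive_infima K) (D : set E)
  (bD : banach_disk D) : Type := disk_space D.

Section Norm.
Context (Kinf : positive_infima K) (D : set E) (bD : banach_disk D).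

Let D0 : D !=set0. Proof. by case: bD. Qed.
Let cD : abs_convex D. Proof. by case: bD. Qed.

Let norm (x : normed_disk_space Kinf bD) : K := minkowski D (disk_val x).

HB.instance Definition _ :=
  GRing.Lmodule.copy (normed_disk_space Kinf bD) (disk_space D).

Let normD x y : norm (x + y) <= norm x + norm y.
Proof. by apply: minkowskiD => //; exact: disk_valP. Qed.

Let normZ a x : norm (a *: x) = `|a| * norm x.
Proof. by rewrite /norm -minkowskiZ//; exact: disk_valP. Qed.

Let norm_eq0 x : norm x = 0 -> x = 0.
Proof.
have [_ _ sepD _] := bD; move=> x0; apply: val_inj.
by apply: sepD x0; exact: disk_valP.
Qed.

HB.instance Definition _ :=
  Lmodule_isNormed.Build K (normed_disk_space Kinf bD) normD normZ norm_eq0.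

Lemma disk_normE (x : normed_disk_space Kinf bD) :
  `|x| = minkowski D (disk_val x).
Proof. by []. Qed.

(** The Banach disk axiom concerns Cauchy sequences, completeness of a uniform
    space Cauchy filters. Choose [c n] whose ball of radius [1 / (n + 1)]
    belongs to the filter: these balls meet pairwise, so [c] is a Cauchy
    sequence, and the filter converges to its limit. *)
Let disk_space_complete (F : set_system (normed_disk_space Kinf bD)) :
  ProperFilter F -> cauchy F -> cvg F.
Proof.
move=> PF /cauchyP cF.
have /choice[c Fc] (n : nat) : exists x, F (ball x (n.+1%:R^-1 : K)).
  by apply: cF; rewrite invr_gt0.
have inv_small (e : K) : 0 < e -> exists N, forall i j,
    (N <= i)%N -> (N <= j)%N -> i.+1%:R^-1 + j.+1%:R^-1 < e.
  move=> e0.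
  have [N eN] := positive_infima_archimedean Kinf (divr_gt0 (ltr0n _ 2) e0).
  have half i : (N <= i)%N -> i.+1%:R^-1 < e / 2.
    move=> Ni; rewrite -invf_div ltf_pV2 ?posrE ?divr_gt0//.
    by apply: lt_le_trans eN _; rewrite ler_nat.
  by exists N => i j /half Ni /half Nj; rewrite (splitr e) ltrD.
have cc i j : `|c i - c j| < i.+1%:R^-1 + j.+1%:R^-1.
  have [z [ciz cjz]] := filter_ex (filterI (Fc i) (Fc j)).
  move: ciz cjz; rewrite -!ball_normE/= => iz jz.
  rewrite -(subrKA z); apply: le_lt_trans (ler_normD _ _) _.
  by rewrite ltrD// distrC.
have [_ _ _ /(_ (fun i => disk_val (c i)))[]] := bD.
- by move=> i; exact: disk_valP.
- move=> e e0; have [N eN] := inv_small e e0; exists N => i j Ni Nj.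
  apply: lt_trans (eN i j Ni Nj).
  by have := cc i j; rewrite disk_normE.
move=> x Dx xc.
pose y : normed_disk_space Kinf bD := DiskSpace (mem_set Dx).
apply/cvg_ex; exists y; apply/cvg_ballP => e e0.
have e20 : 0 < e / 2 by exact: divr_gt0.
have [N1 xN1] := xc _ e20; have [N2 eN2] := inv_small _ e20.
have {}xN1 := xN1 _ (leq_maxl N1 N2).
have {}eN2 := eN2 _ _ (leq_maxr N1 N2) (leq_maxr N1 N2).
apply: filterS (Fc (maxn N1 N2)) => z; rewrite -!ball_normE/= => cz.
rewrite -(subrKA (c (maxn N1 N2))); apply: le_lt_trans (ler_normD _ _) _.
rewrite (splitr e) ltrD//; first by rewrite distrC disk_normE.
apply: lt_trans cz _; apply: le_lt_trans eN2.
by rewrite lerDl invr_ge0.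
Qed.

HB.instance Definition _ :=
  Uniform_isComplete.Build (normed_disk_space Kinf bD) disk_space_complete.

End Norm.

End DiskSpace.

(** * A colimit of Banach disks is an LBb-space *)

Section DiskColimit.
Context {K : numFieldType} (Kinf : positive_infima K) {E : lmodType K}.

Lemma disk_space_boundedP (D : set E) (bD : banach_disk D)
    (A : set (normed_disk_space Kinf bD)) :
  tvs_bornology (normed_disk_space Kinf bD) A <->
  disk_bounded D [set disk_val x | x in A].
Proof.
rewrite normed_boundedP; split=> [[M M0 AM]|[_ [M AM]]].
  split; first by move=> _ [x _ <-]; exact: disk_valP.
  by exists M => _ [x /AM xM <-].
exists (`|M| + 1) => [|x Ax]; first by rewrite ltr_wpDl.
have xM : `|x| <= M by rewrite disk_normE; apply: AM; exists x.
by rewrite ger0_norm ?(le_trans _ xM)// (le_trans xM)// lerDl.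
Qed.

Context (B : bornology E) (D : nat -> set E).
Hypotheses (bD : forall n, banach_disk (D n)) (cD : disk_colimit B D).

Lemma disk_colimit_le n m A : (n <= m)%N ->
  disk_bounded (D n) A -> disk_bounded (D m) A.
Proof.
move=> /subnK <-; elim: (m - n)%N => // k IHk /IHk.
by have [+ _ _] := cD; apply.
Qed.

Lemma disk_bounded_disk n : disk_bounded (D n) (D n).
Proof.
have [D0 aD _ _] := bD n; split; first exact: disk_span_mem.
by exists 1 => x; exact: minkowski_le1.
Qed.

Lemma disk_colimit_disk n : B (D n).
Proof. by have [_ _ ->] := cD; exists n; exact: disk_bounded_disk. Qed.

Lemma disk_span_step n x : disk_span (D n) x -> disk_span (D n.+1) x.
Proof.
move=> Dx; have [step _ _] := cD.
have [|+ _] := step n [set x]; last exact.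
by split=> [_ ->//|]; exists (minkowski (D n) x) => _ ->.
Qed.

Let X n := normed_disk_space Kinf (bD n).

Let link_fun n (x : X n) : X n.+1 :=
  DiskSpace (mem_set (disk_span_step (disk_valP x))).

Let link_linear n : linear (@link_fun n).
Proof. by move=> a x y; exact: val_inj. Qed.

Let link n : {linear X n -> X n.+1} := mk_linear (@link_linear n).

Let link_continuous n : continuous (link n).
Proof.
apply: normed_bounded_continuous => A /disk_space_boundedP bA.
apply/disk_space_boundedP; rewrite image_comp.
by have [+ _ _] := cD; apply.
Qed.

Let link_injective n : injective (link n).
Proof. by move=> x y /(congr1 (@disk_val _ _ _)) xy; exact: val_inj. Qed.

Definition disk_sequence : banach_sequence K :=
  BanachSequence link_continuous link_injective.

Let val_linear n : linear (fun x : X n => disk_val x : E).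
Proof. by []. Qed.

Definition disk_inclusion n : {linear disk_sequence n -> E} :=
  mk_linear (@val_linear n).

(** A cocone [h] is glued to the map that sends [x] to [h n x] for any [n] with
    [x] in the span of [D n]; the cocone condition makes this independent of
    [n], and linear since any two vectors lie in a common span. *)
Lemma disk_colimit_Born_colimit : Born_colimit B disk_inclusion.
Proof.
have [_ cover BE] := cD; split=> //.
  by move=> n A /disk_space_boundedP bA; apply/BE; exists n.
move=> F C h bh ch.
have hE n k x (p : x \in disk_pred (D n)) (q : x \in disk_pred (D (k + n))) :
    h (k + n)%N (DiskSpace q) = h n (DiskSpace p).
  elim: k q => [|k IHk] q; first by rewrite (bool_irrelevance q p).
  have kx : x \in disk_pred (D (k + n)).
    elim: k {IHk q} => // k /set_mem IHk; exact/mem_set/disk_span_step.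
  rewrite -(IHk kx) -(ch (k + n)%N); apply: (congr1 (h (k + n).+1)).
    exact: val_inj.
have hE2 n m x (p : x \in disk_pred (D n)) (q : x \in disk_pred (D m)) :
    h m (DiskSpace q) = h n (DiskSpace p).
  wlog nm : n m p q / (n <= m)%N.
    by move=> W; have [nm|/ltnW mn] := leqP n m; [exact: W|rewrite (W m n)].
  by move: q; rewrite -(subnK nm) => q; exact: hE.
have /choice[N /(_ _)/mem_set Nx] := cover.
pose u x : F := h (N x) (DiskSpace (Nx x)).
have uE n (x : disk_sequence n) : u (disk_val x) = h n x.
  by case: x => x p; exact: hE2.
have lin_u : linear u.
  move=> a x y; pose m := maxn (N x) (N y).
  have up n k z : (n <= k)%N -> disk_span (D n) z -> disk_span (D k) z.
    move=> /subnK <-; elim: (k - n)%N => // j IHj /IHj; exact: disk_span_step.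
  have mx : x \in disk_pred (D m) by apply/mem_set/up/set_mem/(Nx x)/leq_maxl.
  have my : y \in disk_pred (D m) by apply/mem_set/up/set_mem/(Nx y)/leq_maxr.
  have := uE m (a *: DiskSpace mx + DiskSpace my).
  by rewrite linearP -!uE.
exists (mk_linear lin_u); split.
- move=> A /BE[n nA]; have [sA _] := nA.
  have : tvs_bornology (X n) [set x | A (disk_val x)].
    apply/disk_space_boundedP; case: nA => _ [M AM]; split.
      by move=> _ [x _ <-]; exact: disk_valP.
    by exists M => _ [x Ax <-]; exact: AM.
  move=> /bh; apply: bornology_sub => _ [x Ax <-] /=.
  by exists (DiskSpace (mem_set (sA x Ax))) => //; rewrite -uE.
- by move=> n x; exact: uE.
- by move=> v bv vh x; exact: (vh (N x) (DiskSpace (Nx x))).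
Qed.

Lemma disk_colimit_LBb : LBb B.
Proof.
by exists disk_sequence, disk_inclusion; exact: disk_colimit_Born_colimit.
Qed.

End DiskColimit.

(** * Bounded closures and the bounded sets of the associated topology *)

Section Closures.
Context {K : numFieldType}.

(** The closure of [A] lies in [A + 2^-1 W]; if [a] absorbs [A] into [2^-1 W]
    and [`|a| >= 1], both summands lie in [a (2^-1 W)]. *)
Lemma closure_tvs_bounded (E : tvsType K) (A : set E) :
  tvs_bounded A -> tvs_bounded (closure A).
Proof.
move=> bA U U0; have [W [W0 cW WU]] := nbhs0_abs_convex U0.
have half0 : 2^-1 != 0 :> K by rewrite invr_eq0 pnatr_eq0.
have W20 : nbhs (0 : E) [set 2^-1 *: w | w in W] by exact: nbhs0Z.
have [r r0 rW] := bA _ W20; exists (r + 1); first exact: addr_gt0.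
move=> a ra x Ax.
have a1 : 1 <= `|a| by apply: le_trans ra; rewrite lerDr ltW.
have a0 : a != 0 by rewrite -normr_gt0; apply: lt_le_trans a1.
have [y [Ay [_ [w2 Ww2 <-] xy]]] := Ax _ (nbhsT x W20).
have {}ra : r <= `|a| by apply: le_trans ra; rewrite lerDl.
have [_ [w1 Ww1 <-] wy] := rW a ra y Ay.
exists (2^-1 *: w1 + (- (a^-1 * 2^-1)) *: w2).
  apply/WU/cW => //; rewrite normrN normrM !normfV normr_nat.
  apply: (@le_trans _ _ (2^-1 + 2^-1)); last by rewrite half_half.
  rewrite lerD2l ler_piMl ?invr_ge0//.
  by rewrite invf_le1// (lt_le_trans _ a1).
rewrite scalerDr wy -xy scaleNr scalerN [X in _ - X]scalerA mulrA divff// mul1r.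
by rewrite addrK.
Qed.

Lemma closureZ (E : tvsType K) (c : K) (A : set E) : c != 0 ->
  closure [set c *: x | x in A] `<=` [set c *: x | x in closure A].
Proof.
move=> c0 x Ax; exists (c^-1 *: x); last by rewrite scalerA divff// scale1r.
have lin : linear (fun y : E => c^-1 *: y).
  by move=> a y z; rewrite scalerDr !scalerA mulrC.
have cZ : continuous (mk_linear lin).
  apply: linear_continuous0 => U U0.
  apply: filterS (nbhs0Z c0 U0) => _ [u Uu <-].
  by rewrite /= scalerA mulVf// scale1r.
move=> U Ux.
have [_ [[y Ay <-] ]] := Ax _ (cZ x U Ux).
by rewrite /= scalerA mulVf// scale1r; exists y.
Qed.

Context {E : lmodType K} (B : bornology E).

Lemma bornivorous0 (V : set E) : abs_convex V -> bornivorous B V -> V 0.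
Proof.
move=> cV bV; have [A BA A0] := bornology_cover B 0.
have [r r0 /(_ r)] := bV A BA.
rewrite gtr0_norm// => /(_ (lexx _) _ A0)[v Vv _].
by apply: abs_convex0 => //; exists v.
Qed.

Lemma abs_convexD (A C : set E) : abs_convex A -> abs_convex C ->
  abs_convex [set x + y | x in A & y in C].
Proof.
move=> cA cC a b _ _ ab [x Ax [y Cy <-]] [x' Ax' [y' Cy' <-]].
exists (a *: x + b *: x'); first exact: cA.
exists (a *: y + b *: y'); first exact: cC.
by rewrite !scalerDr addrACA.
Qed.

Lemma absorbs_bigcap (j : nat) (V : nat -> set E) (A : set E) :
  (forall k, absorbs (V k) A) -> absorbs (\bigcap_(k in `I_j) V k) A.
Proof.
move=> VA; elim: j => [|j IHj].
  exists 1 => // a a1 x _.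
  have a0 : a != 0 by rewrite -normr_gt0 (lt_le_trans _ a1).
  by exists (a^-1 *: x); [move=> ?|rewrite scalerA divff// scale1r].
apply: absorbs_superset (absorbsI IHj (VA j)) => v [Vv Vj] k /=.
by rewrite ltnS leq_eqVlt => /predU1P[->//|]; exact: Vv.
Qed.

(** The gliding hump. The set [V] built from a set [A] outside [B] is
    bornivorous for the following reason: [T j] is contained in [T k + W k] for
    [k >= j], and is absorbed by the finite intersection of the [W k] with
    [k < j]. *)
Lemma countable_base_NBorn (Kinf : positive_infima K) (T : nat -> set E) :
  (forall k, T k 0) -> (forall k, abs_convex (T k)) ->
  (forall k, T k `<=` T k.+1) ->
  (forall A, B A <-> exists k, A `<=` T k) ->
  (forall k, B (closure (T k : set (born_top B)))) ->
  NBorn B.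
Proof.
move=> T0 cT Tmono BT clT A; split; last exact: bounded_sets_tvs_bounded.
rewrite tvs_bornologyE => bA; apply: contrapT => nBA.
have /choice[x /all_and2[Ax xT]] k : exists x,
    A x /\ ~ closure (T k : set (born_top B)) (k.+1%:R^-1 *: x).
  apply: contrapT => nx; apply: nBA.
  apply: bornology_sub (bornologyZ k.+1%:R (clT k)) => y Ay.
  exists (k.+1%:R^-1 *: y); last by rewrite scalerA divff ?scale1r// pnatr_eq0.
  by apply: contrapT => ny; apply: nx; exists y.
have /choice[W WP] k : exists W : set E, [/\ abs_convex W, bornivorous B W &
    forall t w, T k t -> W w -> t + w <> k.+1%:R^-1 *: x k].
  have /existsNP[V /not_implyP[[W [cW bW WV]] TV]] := xT k.
  exists W; split=> // t w Tt Ww tw; apply: TV; exists t; split=> //; apply: WV.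
  exists (- w); last by rewrite -tw addrK.
  rewrite -scaleN1r; apply: abs_convexZ; rewrite ?normrN ?normr1//.
  by exists w.
have TW k : abs_convex [set t + w | t in T k & w in W k].
  by apply: abs_convexD; [exact: cT|have [] := WP k].
pose V := \bigcap_k [set t + w | t in T k & w in W k].
have bV : bornivorous B V.
  move=> C /BT[j CT]; apply: (absorbs_subset CT).
  have Tj_le k : (j <= k)%N -> T j `<=` T k.
    by move=> /subnK <-; elim: (k - j)%N => // n IHn y /IHn/Tmono.
  have : absorbs (T j `&` \bigcap_(k in `I_j) W k) (T j).
    apply: absorbsI; last first.
      apply: absorbs_bigcap => k; have [_ + _] := WP k; apply.
      by apply/BT; exists j.
    exists 1 => // a a1 y Ty.
    have a0 : 0 < `|a| by rewrite (lt_le_trans _ a1).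
    exists (a^-1 *: y); last by rewrite scalerA divff ?scale1r// -normr_gt0.
    by apply: abs_convexZ => //; [exists 0|rewrite normfV invf_le1].
  apply: absorbs_superset => y [Ty Wy] k _.
  have [cW bW _] := WP k; have [jk|kj] := leqP j k.
    exists y; first exact: Tj_le Ty.
    by exists 0; [exact: bornivorous0|rewrite addr0].
  by exists 0 => //; exists y; [exact: Wy|rewrite add0r].
have [|r r0 rV] := bA V.
  by apply/born_top_nbhs0P; exists V; split=> //; exact: abs_convexI.
have [k rk] := positive_infima_archimedean Kinf r0.
have [|v /(_ k I)[t Tt [w Ww tw]] vx] := rV k.+1%:R _ (x k) (Ax k).
  by rewrite gtr0_norm// ltW.
have [_ _ /(_ t w Tt Ww)] := WP k; apply.
by rewrite tw -vx scalerA mulVf ?scale1r// pnatr_eq0.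
Qed.

End Closures.

(** The Hahn-Banach theorem for a seminorm and the line through one vector. *)
Definition seminorm_extension (F : numFieldType) : Prop :=
  forall (V : lmodType F) (p : V -> F),
    (forall x, 0 <= p x) -> (forall x y, p (x + y) <= p x + p y) ->
    (forall a x, p (a *: x) = `|a| * p x) ->
    forall e, p e != 0 ->
    exists f : {scalar V}, f e != 0 /\ forall x, `|f x| <= p x.

Section DiskClosures.
Context {K : numFieldType} (Kinf : positive_infima K) {E : lmodType K}.
Context (B : bornology E) (D : nat -> set E).
Hypotheses (bD : forall n, banach_disk (D n)) (cD : disk_colimit B D).

Let D0 n : D n !=set0. Proof. by have [] := bD n. Qed.
Let aD n : abs_convex (D n). Proof. by have [] := bD n. Qed.

Lemma NBorn_closures_bounded : NBorn B -> closures_bounded B D.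
Proof.
move=> NB n.
have /NB : tvs_bornology (born_top B) (closure (D n : set (born_top B))).
  apply: closure_tvs_bounded; apply: bounded_sets_tvs_bounded.
  exact: (disk_colimit_disk Kinf bD cD).
have [_ _ BE] := cD; move=> /BE[m mD]; exists (maxn n m); first exact: leq_maxl.
apply: (disk_colimit_le cD (leq_maxr n m)).
exact: mD.
Qed.

Lemma disk_bounded_dilation n A : disk_bounded (D n) A ->
  exists2 c : K, 0 < c & A `<=` [set c *: d | d in D n].
Proof.
move=> [sA [M AM]]; exists (`|M| + 1) => [|x Ax]; first by rewrite ltr_wpDl.
apply: minkowski_lt => //; first exact: sA.
have x0 : 0 <= minkowski (D n) x by apply: minkowski_ge0 => //; exact: sA.
have xM := AM x Ax; rewrite (ger0_norm (le_trans x0 xM)).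
by apply: le_lt_trans xM _; rewrite ltrDl.
Qed.

Lemma closures_bounded_closure A : closures_bounded B D -> B A ->
  B (closure (A : set (born_top B))).
Proof.
have [_ _ BE] := cD.
move=> clD /BE[n /disk_bounded_dilation[c c0 Ac]].
have /(bornologyZ c) : B (closure (D n : set (born_top B))).
  by have [m _ mD] := clD n; apply/BE; exists m.
apply: bornology_sub => x /(@closure_subset (born_top B) _ _ Ac).
by apply: (@closureZ _ (born_top B)); rewrite gt_eqF.
Qed.

(** A cofinal sequence of bounded sets. Doubling makes the sequence increasing
    and absorbing at once: [2 ^ i *: D n] is contained in the term of index
    [i + n + 1]. *)
Fixpoint disk_base (k : nat) : set E :=
  if k is j.+1 then
    [set x + y | x in [set 2 *: t | t in disk_base j] & y in D j]
  else [set 0].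

Let disk_base_convex k : abs_convex (disk_base k).
Proof.
elim: k => [|k IHk]; last by apply: abs_convexD => //; exact: abs_convex_scale.
by move=> a b _ _ _ -> ->; rewrite !scaler0 addr0.
Qed.

Let disk_base_bounded k : B (disk_base k).
Proof.
elim: k => [|k IHk].
  have [A BA A0] := bornology_cover B 0.
  by apply: bornology_sub BA => _ ->.
by apply: bornologyD; [exact: bornologyZ|exact: (disk_colimit_disk Kinf bD cD)].
Qed.

Let disk_base_double k t : disk_base k t -> disk_base k.+1 (2 *: t).
Proof.
move=> kt; exists (2 *: t); first by exists t.
by exists 0; [exact: abs_convex0|rewrite addr0].
Qed.

Let disk_base0 k : disk_base k 0.
Proof.
by elim: k => [//|k IHk]; rewrite -(scaler0 _ 2); exact: disk_base_double.
Qed.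

Let disk_base_succ k : disk_base k `<=` disk_base k.+1.
Proof.
move=> t kt; rewrite -(scale1r t) -(divff (_ : 2 != 0 :> K)) ?pnatr_eq0//.
rewrite -scalerA; apply: disk_base_double.
apply: abs_convexZ => //; first by exists 0.
by rewrite normfV invf_le1 ?normr_nat// ler1n.
Qed.

Let disk_base_cofinal A : B A <-> exists k, A `<=` disk_base k.
Proof.
split=> [|[k Ak]]; last exact: bornology_sub Ak (disk_base_bounded k).
have [_ _ BE] := cD; move=> /BE[n /disk_bounded_dilation[c c0 Ac]].
have [j cj] := positive_infima_archimedean Kinf c0.
have pow i d : D n d -> disk_base (i + n.+1) ((2 ^ i)%:R *: d).
  move=> Dd; elim: i => [|i IHi].
    exists 0; first by exists 0; rewrite ?scaler0.
    by exists d; rewrite // add0r scale1r.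
  by rewrite expnS natrM -scalerA; exact: disk_base_double.
exists (j.+1 + n.+1)%N => x /Ac[d Dd <-].
have j2 : 0 < (2 ^ j.+1)%:R :> K by rewrite ltr0n expn_gt0.
have -> : c *: d = (c / (2 ^ j.+1)%:R) *: ((2 ^ j.+1)%:R *: d).
  by rewrite scalerA divfK// gt_eqF.
apply: abs_convexZ; [by exists 0|exact: disk_base_convex| |exact: pow].
rewrite gtr0_norm ?divr_gt0// ler_pdivrMr// mul1r (le_trans (ltW cj))//.
by rewrite ler_nat ltnW// ltn_expl.
Qed.

Lemma closures_bounded_NBorn : closures_bounded B D -> NBorn B.
Proof.
move=> clD; apply: (countable_base_NBorn Kinf (T := disk_base)) => // k.
exact: closures_bounded_closure.
Qed.

(** If all absolutely convex bornivorous sets contained [e], they would contain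
    the line through [e], since their multiples are such sets too. That line
    would be bounded in some [E_(D n)], and the norm of [e] there would be
    [0]. *)
Lemma NBorn_separated e : NBorn B -> e != 0 ->
  exists V, [/\ abs_convex V, bornivorous B V & ~ V e].
Proof.
move=> NB e0; apply: contrapT => nV.
have eV V : abs_convex V -> bornivorous B V -> V e.
  by move=> cV bV; apply: contrapT => Ve; apply: nV; exists V.
have [_ _ BE] := cD.
have /NB/BE[n [sL [M LM]]] :
    tvs_bornology (born_top B) [set a *: e | a in setT].
  rewrite tvs_bornologyE => U /born_top_nbhs0P[V [cV bV VU]].
  exists 1 => // a a1 _ [c _ <-].
  have a0 : a != 0 by rewrite -normr_gt0 (lt_le_trans _ a1).
  exists (a^-1 *: (c *: e)); last by rewrite scalerA divff// scale1r.
  apply: VU; have [->|c0] := eqVneq c 0.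
    by rewrite scale0r scaler0; exact: bornivorous0 cV bV.
  have [b0 b1] : a^-1 * c != 0 /\ (a^-1 * c)^-1 != 0.
    by rewrite invr_eq0 mulf_neq0// invr_eq0.
  have := eV _ (abs_convex_scale (c := (a^-1 * c)^-1) cV)
    (fun A BA => absorbs_scale b1 (bV A BA)).
  by move=> [v Vv <-]; rewrite !scalerA divff// scale1r.
have De : disk_span (D n) e by apply: sL; exists 1; rewrite ?scale1r.
have [_ _ nD _] := bD n; have /eqP := e0; apply; apply: nD => //.
apply/eqP; case: eqP => // /eqP me0.
have m0 : 0 < minkowski (D n) e by rewrite lt_def me0 minkowski_ge0.
have M0 : 0 <= M.
  by apply: le_trans (ltW m0) (LM e _); exists 1; rewrite ?scale1r.
have c0 : 0 < (M + 1) / minkowski (D n) e by rewrite divr_gt0// ltr_wpDl.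
have : minkowski (D n) (((M + 1) / minkowski (D n) e) *: e) <= M.
  by apply: LM; exists ((M + 1) / minkowski (D n) e).
by rewrite minkowskiZ// (gtr0_norm c0) divfK// gerDl ler10.
Qed.

(** A functional dominated by the gauge of a bornivorous [V] is bounded on every
    bounded set; the gauge of [V] is positive at [e] when [V] misses [e]. *)
Lemma NBorn_functionals_separate (Kext : seminorm_extension K) :
  NBorn B -> functionals_separate D.
Proof.
move=> NB e e0; have [V [cV bV Ve]] := NBorn_separated NB e0.
have V0 : V !=set0 by exists 0; exact: bornivorous0 cV bV.
have sV x : disk_span V x.
  have [A BA Ax] := bornology_cover B x; have [r r0 rV] := bV A BA.
  by apply/disk_spanP => //; exists r => //; apply: rV; rewrite ?gtr0_norm.
have [|x y|a x||f [fe fV]] := Kext E (minkowski V) _ _ _ e.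
- by move=> x; exact: minkowski_ge0.
- exact: minkowskiD.
- exact: minkowskiZ.
- apply/eqP => e00; apply: Ve.
  have := @minkowski_lt _ Kinf _ V V0 cV 1 e (sV e); rewrite e00 => /(_ ltr01).
  by move=> [v Vv <-]; rewrite scale1r.
exists f => // n; have [r r0 rV] := bV _ (disk_colimit_disk Kinf bD cD n).
exists r => d Dd; apply: le_trans (fV d) _.
by apply: minkowski_le => //; apply: rV; rewrite ?gtr0_norm.
Qed.

End DiskClosures.

(** * The Hahn-Banach theorem over the reals *)

Section Sublinear.
Context {R : realType} {E : lmodType R}.
Implicit Types (p q : E -> R) (x y : E).

Definition sublinear p : Prop :=
  (forall x y, p (x + y) <= p x + p y) /\
  (forall (s : R) x, 0 < s -> p (s *: x) <= s * p x).

Lemma sublinearZ p (s : R) x : sublinear p -> 0 <= s -> p (s *: x) = s * p x.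
Proof.
move=> [_ pZ]; rewrite le_eqVlt => /predU1P[<-|s0].
  rewrite scale0r mul0r; apply/eqP; rewrite eq_le; apply/andP; split.
    have := pZ 2^-1 0; rewrite scaler0 invr_gt0 => /(_ (ltr0Sn _ _)); lra.
  have := pZ 2 0; rewrite scaler0 => /(_ (ltr0Sn _ _)); lra.
apply/eqP; rewrite eq_le pZ//= -ler_pdivlMl// -{1}(scale1r x).
by rewrite -(mulVf (lt0r_neq0 s0)) -scalerA pZ// invr_gt0.
Qed.

Lemma sublinear_lbound p x : sublinear p -> - p (- x) <= p x.
Proof.
move=> sp; have [pD _] := sp; rewrite -subr_ge0 opprK.
by have := pD x (- x); rewrite subrr -(scale0r 0) sublinearZ// mul0r.
Qed.

(** Subtracting the slope of [p] in the direction [y] produces a sublinear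
    functional below [p] whose value at [- y] is at most [- p y]. It is used
    twice: to see that minimal sublinear functionals are additive, and to fix
    the value of the functional of the Hahn-Banach theorem at one vector. *)
Definition descend p y x : R :=
  inf [set p (x + t *: y) - t * p y | t in [set t : R | 0 <= t]].

Section Descend.
Variables (p : E -> R) (y : E).
Hypothesis sp : sublinear p.

Let descend_lb x : lbound
  [set p (x + t *: y) - t * p y | t in [set t : R | 0 <= t]] (- p (- x)).
Proof.
move=> _ [t /= t0 <-]; have [pD _] := sp.
have := pD (x + t *: y) (- x).
rewrite addrAC subrr add0r sublinearZ//; lra.
Qed.

Lemma descend_le (t : R) x : 0 <= t ->
  descend p y x <= p (x + t *: y) - t * p y.
Proof.
move=> t0; apply: ge_inf; first by exists (- p (- x)); exact: descend_lb.
by exists t.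
Qed.

Lemma le_descend (m : R) x :
  (forall t, 0 <= t -> m <= p (x + t *: y) - t * p y) -> m <= descend p y x.
Proof.
move=> mt; apply: lb_le_inf => [|_ [t t0 <-]]; last exact: mt.
by exists (p (x + 0 *: y) - 0 * p y), 0 => /=.
Qed.

Lemma descend_sublinear : sublinear (descend p y).
Proof.
have [pD _] := sp; split=> [x x'|s x s0].
  rewrite -lerBlDr; apply: le_descend => t t0.
  rewrite lerBlDr -lerBlDl; apply: le_descend => t' t'0; rewrite lerBlDl.
  apply: le_trans (descend_le _ (addr_ge0 t0 t'0)) _.
  have := pD (x + t *: y) (x' + t' *: y).
  by rewrite addrACA -scalerDl; lra.
rewrite -ler_pdivrMl//; apply: le_descend => t t0; rewrite ler_pdivrMl//.
apply: le_trans (descend_le _ (mulr_ge0 (ltW s0) t0)) _.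
by rewrite -scalerA -scalerDr (sublinearZ _ sp (ltW s0)) mulrBr mulrA.
Qed.

Lemma descend_le_self x : descend p y x <= p x.
Proof.
by have := descend_le x (lexx 0); rewrite scale0r addr0 mul0r subr0.
Qed.

Lemma descend_opp : descend p y (- y) <= - p y.
Proof.
have := descend_le (- y) ler01.
rewrite scale1r addNr mul1r -(scale0r 0) sublinearZ// mul0r; lra.
Qed.

End Descend.

(** Minimality gives [descend p y = p], and the term [t = 1] of the infimum that
    defines [descend p y x] gives [p x <= p (x + y) - p y], the converse of
    subadditivity. *)
Lemma minimal_sublinear_linear p : sublinear p ->
  (forall q, sublinear q -> (forall x, q x <= p x) -> q = p) -> scalar p.
Proof.
move=> sp pmin; have [pD _] := sp.
have addp x y : p (x + y) = p x + p y.
  apply/eqP; rewrite eq_le pD/=.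
  have := descend_le y sp x ler01.
  rewrite (pmin _ (descend_sublinear y sp) (descend_le_self y sp)).
  by rewrite scale1r mul1r lerBrDr.
have p0 : p 0 = 0 by rewrite -(scale0r 0) sublinearZ// mul0r.
have oppp x : p (- x) = - p x by apply/eqP; rewrite -addr_eq0 -addp addNr p0.
move=> a x y; rewrite addp; congr (_ + _) => /=.
have [a0|a0] := leP 0 a; first exact: sublinearZ.
rewrite -[a]opprK scaleNr oppp (sublinearZ _ sp) ?oppr_ge0 ?(ltW a0)//.
by rewrite -mulNr.
Qed.

(** By Zorn's lemma: the pointwise infimum of a chain is finite, as
    [- q (- x)] bounds the values at [x] from below, and it is subadditive since
    of two members of a chain the smaller one is below both. *)
Lemma exists_minimal_sublinear q : sublinear q ->
  exists p, [/\ sublinear p, forall x, p x <= q x &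
    forall p', sublinear p' -> (forall x, p' x <= p x) -> p' = p].
Proof.
move=> sq.
pose T := {p : E -> R | sublinear p /\ forall x, p x <= q x}.
pose below (p p' : T) := `[< forall x, sval p' x <= sval p x >].
have [|||C totC|[p [sp pq]] pmin] := @Zorn T below.
- by move=> t; apply/asboolP.
- move=> r s t /asboolP rs /asboolP st; apply/asboolP => x.
  exact: le_trans (rs x).
- move=> [s Ps] [t Pt] /asboolP/= st /asboolP/= ts; apply: eq_exist.
  by apply/funext => x; apply/eqP; rewrite eq_le ts st.
- have [->|/set0P[c0 Cc0]] := eqVneq C set0.
    by exists (exist _ q (conj sq (fun x => lexx _))) => ? [].
  pose V x := [set sval c x | c in C]; pose m x := inf (V x).
  have V0 x : V x !=set0 by exists (sval c0 x), c0.
  have Vlb x : lbound (V x) (- q (- x)).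
    move=> _ [[c [sc cq]] _ <-] /=; apply: le_trans (sublinear_lbound x sc).
    by rewrite lerN2.
  have m_le (c : T) x : C c -> m x <= sval c x.
    by move=> Cc; apply: ge_inf; [exists (- q (- x)); exact: Vlb|exists c].
  have le_m (l : R) x : (forall c : T, C c -> l <= sval c x) -> l <= m x.
    by move=> lc; apply: lb_le_inf => // _ [c Cc <-]; exact: lc.
  have sm : sublinear m.
    split=> [x x'|s x s0].
      rewrite -lerBlDr; apply: (le_m) => c Cc.
      rewrite lerBlDr -lerBlDl; apply: (le_m) => c' Cc'; rewrite lerBlDl.
      have [/asboolP cc'|/asboolP cc'] := totC _ _ Cc Cc'.
        apply: le_trans (m_le c' _ Cc') _.
        case: c' {Cc'} cc' => c' [[c'D _] c'q] /= cc'.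
        by apply: le_trans (c'D _ _) _; rewrite lerD2r.
      apply: le_trans (m_le c _ Cc) _; case: c {Cc} cc' => c [[cD _] cq] /= cc'.
      by apply: le_trans (cD _ _) _; rewrite lerD2l.
    rewrite -ler_pdivrMl//; apply: (le_m) => c Cc; rewrite ler_pdivrMl//.
    apply: le_trans (m_le c _ Cc) _.
    by case: c {Cc} => c [[_ cZ] cq] /=; exact: cZ.
  have mq x : m x <= q x.
    by apply: le_trans (m_le c0 x Cc0) _; case: (c0) => c [_ cq] /=.
  exists (exist _ m (conj sm mq)) => c Cc; apply/asboolP => x /=.
  exact: m_le.
- exists p; split=> // p' sp' p'p.
  have p'q x : p' x <= q x by exact: le_trans (pq x).
  have := pmin (exist _ p' (conj sp' p'q)) (asboolT p'p).
  by move=> /(congr1 sval).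
Qed.

(** A minimal sublinear functional [p] below [descend q e] is linear, and
    [- p e = p (- e) <= - q e] gives the value at [e]. *)
Lemma real_Hahn_Banach q e : sublinear q ->
  exists f : {scalar E}, f e = q e /\ forall x, f x <= q x.
Proof.
move=> sq.
have [p [sp pq pmin]] := exists_minimal_sublinear (descend_sublinear e sq).
have lp := minimal_sublinear_linear sp pmin.
pose f : {scalar E} := HB.pack p (GRing.isLinear.Build R E R *%R p lp).
have fq x : f x <= q x by apply: le_trans (pq x) _; exact: descend_le_self.
exists f; split=> //; apply/eqP; rewrite eq_le fq/=.
have fN : p (- e) = - p e := linearN f e.
by have := le_trans (pq (- e)) (descend_opp e sq); rewrite fN lerN2.
Qed.

End Sublinear.

(** * The two fields of scalars *)

Section Scalars.
Context {R : realType}.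
Local Open Scope complex_scope.

Lemma real_positive_infima : positive_infima R.
Proof.
move=> S S0 S_gt0; have S_ge0 : lbound S 0 by move=> l /S_gt0/ltW.
exists (inf S); split=> [l Sl|m mS]; last exact: lb_le_inf.
by apply: ge_inf => //; exists 0.
Qed.

Lemma complex_positive_infima : positive_infima R[i].
Proof.
move=> S [l0 Sl0] S_gt0.
have S_real l : S l -> l = (complex.Re l)%:C.
  by move=> /S_gt0; case: l => a b; rewrite ltcE /= => /andP[/eqP -> _].
have [|_ [l Sl <-]|i [iS Si]] :=
  @real_positive_infima [set complex.Re l | l in S].
- by exists (complex.Re l0); exists l0.
- by move: (S_gt0 l Sl); rewrite ltcE => /andP[].
exists i%:C; split=> [l Sl|m mS].
  by rewrite (S_real l Sl) lecR; apply: iS; exists l.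
have : m <= l0 by exact: mS.
rewrite (S_real _ Sl0) lecE /= => /andP[/eqP m0 _].
rewrite lecE /= -m0 eqxx/=; apply: Si => _ [l Sl <-].
by have := mS l Sl; rewrite lecE => /andP[].
Qed.

Lemma real_seminorm_extension : seminorm_extension R.
Proof.
move=> V p p0 pD pZ e pe.
have [|f [fe fp]] := @real_Hahn_Banach R V p e.
  by split=> // s x s0; rewrite pZ gtr0_norm.
exists f; rewrite fe; split=> // x.
rewrite ler_norml fp andbT lerNl -linearN (le_trans (fp _))//.
by rewrite -scaleN1r pZ normrN1 mul1r.
Qed.

Definition realified (V : lmodType R[i]) : Type := V.

Section Realified.
Variable V : lmodType R[i].

HB.instance Definition _ := GRing.Zmodule.copy (realified V) V.

Let real_scale (a : R) (x : realified V) : realified V := a%:C *: (x : V).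

Let real_scaleA a b x : real_scale a (real_scale b x) = real_scale (a * b) x.
Proof. by rewrite /real_scale scalerA rmorphM. Qed.

Let real_scale1 : left_id 1 real_scale.
Proof. by move=> x; rewrite /real_scale rmorph1 scale1r. Qed.

Let real_scaleDr : right_distributive real_scale +%R.
Proof. by move=> a x y; exact: scalerDr. Qed.

Let real_scaleDl x : {morph real_scale^~ x : a b / a + b}.
Proof. by move=> a b; rewrite /real_scale rmorphD scalerDl. Qed.

HB.instance Definition _ := GRing.Zmodule_isLmodule.Build R (realified V)
  real_scaleA real_scale1 real_scaleDr real_scaleDl.

Lemma realified_scaleE (a : R) (x : realified V) :
  a *: x = a%:C *: (x : V) :> V.
Proof. by []. Qed.

End Realified.

(** A real functional [g] dominated by the seminorm is the real part of the
    complex functional [f x = g x - i g (i x)]. Rotating [x] so that [f x]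
    becomes its modulus reduces the bound on [`|f x|] to the bound on [g]. *)
Lemma complex_seminorm_extension : seminorm_extension R[i].
Proof.
move=> V p p0 pD pZ e pe.
have [|g [ge gp]] :=
  @real_Hahn_Banach R (realified V) (fun x => complex.Re (p x)) e.
  split=> [x y|s x s0].
    have := pD x y; rewrite lecE => /andP[_].
    by case: (p x) => a b; case: (p y).
  rewrite realified_scaleE pZ gtr0_norm ?ltcR//.
  by case: (p x) => a b /=; rewrite mul0r subr0.
have p_Re x : p x = (complex.Re (p x))%:C.
  by have := p0 x; case: (p x) => a b; rewrite lecE /= => /andP[/eqP -> _].
pose i : R[i] := 0 +i* 1.
have ii (x : V) : i *: (i *: x) = - x.
  rewrite scalerA -scaleN1r; congr (_ *: _); apply/eqP.
  rewrite eq_complex /= !(mul0r, mulr0, mulr1, mul1r, add0r, addr0, oppr0).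
  by rewrite !eqxx.
pose f (x : V) : R[i] := g x +i* - g (i *: x).
have gZ (a : R) (x : V) : g (a%:C *: x) = a * g x.
  by rewrite -[LHS]/(g (a *: (x : realified V))) linearZ.
have gD (x y : V) : g (x + y) = g x + g y by exact: (linearD g).
have gN (x : V) : g (- x) = - g x by exact: (linearN g).
have gC (a : R[i]) (x : V) :
    g (a *: x) = complex.Re a * g x + complex.Im a * g (i *: x).
  have {1}-> : a = (complex.Re a)%:C + (complex.Im a)%:C * i.
    by case: a => u v; rewrite /i; simpc.
  by rewrite scalerDl gD gZ -scalerA gZ.
have lf : scalar f.
  move=> a x y; apply/eqP; rewrite eq_complex /f /= scalerDr !gD (gC a x).
  have -> : i *: (a *: x) = a *: (i *: x) by rewrite !scalerA mulrC.
  rewrite (gC a (i *: x)) ii gN.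
  case: a => u v /=; apply/andP; split; apply/eqP; ring.
pose F : {scalar V} := HB.pack f (GRing.isLinear.Build R[i] V R[i] *%R f lf).
exists F; split.
  apply: contra_neq pe => /(congr1 (@complex.Re R)) /= g0.
  by rewrite p_Re -ge g0.
move=> x; have [fx0|fx0] := eqVneq (F x) 0; first by rewrite fx0 normr0.
pose c := `|F x| / F x.
have c1 : `|c| = 1 by rewrite normrM normfV normr_id divff// normr_eq0.
have Fcx : F (c *: x) = `|F x| by rewrite linearZ/= divfK.
have := gp (c *: x); rewrite pZ c1 mul1r => gpx.
have fg : complex.Re `|F x| <= complex.Re (p x) by rewrite -Fcx.
have := normr_ge0 (F x); rewrite p_Re; case: (`|F x|) fg => u v /= up.
by rewrite !lecE /= => /andP[/eqP -> _]; rewrite eqxx.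
Qed.

End Scalars.

(** * The characterization of bLB *)

Theorem theorem3p11 (R : realType) (k : scalar_kind) :
  (forall (E : lmodType (scalars R k)) (B : bornology E) (D : nat -> set E),
     (forall n, banach_disk (D n)) -> disk_colimit B D ->
     bLB B <-> functionals_separate D /\ closures_bounded B D) /\
  (forall (E : lmodType (scalars R k)) (B : bornology E),
     bLB B <-> LBb B /\ NBorn B).
Proof.
have Kinf : positive_infima (scalars R k).
  by case: k; [exact: real_positive_infima|exact: complex_positive_infima].
have Kext : seminorm_extension (scalars R k).
  case: k {Kinf}; first exact: real_seminorm_extension.
  exact: complex_seminorm_extension.
split=> [E B D bD cD|E B]; split.
- move=> /bLB_LBb_NBorn[_ NB]; split.
    exact: NBorn_functionals_separate Kinf _ _ _ bD cD Kext NB.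
  exact: NBorn_closures_bounded Kinf _ _ _ bD cD NB.
- move=> [_ clD]; apply: LBb_NBorn_bLB.
    exact (disk_colimit_LBb Kinf bD cD).
  exact (closures_bounded_NBorn Kinf bD cD clD).
- exact: bLB_LBb_NBorn.
- by move=> [LB NB]; exact: LBb_NBorn_bLB.
Qed.
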